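(* Let $p\ge q\ge 2$ be integers, $a,b\in\mathbb{C}$, and suppose that the map $F(z,w)=z^p+w^q+a\bar z+b\bar w$, regarded as a map $\mathbb{R}^4\to\mathbb{R}^2$, is an excellent map. Then the number of cusps of $F$ lies in the interval $[(p+1)(q-1),\,(p-1)(q+1)]$. In particular, if $p=q$ then $F$ has exactly $p^2-1$ cusps.
   Context: A smooth map $g:X^4\to Y^2$ is an excellent map if for every $x\in X$ there are local coordinates $(x_1,\dots,x_4)$ centered at $x$ and $(y_1,y_2)$ centered at $g(x)$ in which $g$ takes one of the forms: (1) $(x_1,x_2)$; (2) $(x_1,x_2^2+x_3^2+x_4^2)$ (definite fold); (3) $(x_1,x_2^2+x_3^2-x_4^2)$ (indefinite fold); (4) $(x_1,x_2^2\pm x_3^2+x_1x_4+x_4^3)$ (cusp). *)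

(* Defs.v *)
From Stdlib Require Import Reals Lra Lia Arith List.
Open Scope R_scope.

(** * Euclidean space R^n as real sequences vanishing beyond index n
    (coordinates x_1..x_n of the paper are indices 0..n-1). *)
Definition Rn (n : nat) : Type := {v : nat -> R | forall i, (n <= i)%nat -> v i = 0}.

Definition coord {n : nat} (v : Rn n) (i : nat) : R := proj1_sig v i.

Definition Rn0 (n : nat) : Rn n := exist _ (fun _ => 0) (fun _ _ => eq_refl).

Lemma upd_ok (n : nat) (v : Rn n) (i : nat) (t : R) :
  forall j, (n <= j)%nat ->
    (if (Nat.eqb j i && Nat.ltb i n)%bool then t else proj1_sig v j) = 0.
Proof.
  intros j Hj. destruct (Nat.eqb j i) eqn:E1; destruct (Nat.ltb i n) eqn:E2; simpl;
  try (apply (proj2_sig v); exact Hj).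
  apply Nat.eqb_eq in E1. apply Nat.ltb_lt in E2. lia.
Qed.

(** v with its i-th coordinate replaced by t (no-op if i >= n). *)
Definition upd {n : nat} (v : Rn n) (i : nat) (t : R) : Rn n :=
  exist _ (fun j => if (Nat.eqb j i && Nat.ltb i n)%bool then t else proj1_sig v j)
        (upd_ok n v i t).

Lemma mk2_ok (a b : R) :
  forall i, (2 <= i)%nat -> (match i with 0%nat => a | 1%nat => b | _ => 0 end) = 0.
Proof. intros [|[|i]] H; [lia|lia|reflexivity]. Qed.

Definition mk2 (a b : R) : Rn 2 :=
  exist _ (fun i => match i with 0%nat => a | 1%nat => b | _ => 0 end) (mk2_ok a b).

Definition near {n : nat} (x y : Rn n) (eps : R) : Prop :=
  forall i, (i < n)%nat -> Rabs (coord y i - coord x i) < eps.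

Definition open_set {n : nat} (U : Rn n -> Prop) : Prop :=
  forall x, U x -> exists eps, eps > 0 /\ forall y, near x y eps -> U y.

Definition continuous_on {n : nat} (U : Rn n -> Prop) (f : Rn n -> R) : Prop :=
  forall x, U x -> forall eps, eps > 0 ->
    exists delta, delta > 0 /\ forall y, U y -> near x y delta -> Rabs (f y - f x) < eps.

Definition has_partial {n : nat} (U : Rn n -> Prop) (f : Rn n -> R) (i : nat)
  (g : Rn n -> R) : Prop :=
  forall x, U x -> derivable_pt_lim (fun t => f (upd x i t)) (coord x i) (g x).

Fixpoint Ck (k : nat) {n : nat} (U : Rn n -> Prop) (f : Rn n -> R) : Prop :=
  match k with
  | O => continuous_on U f
  | S k' => continuous_on U f /\
      forall i, (i < n)%nat -> exists g, has_partial U f i g /\ Ck k' U g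
  end.

Definition smooth_on {n : nat} (U : Rn n -> Prop) (f : Rn n -> R) : Prop :=
  forall k, Ck k U f.

Definition smooth_map_on {n m : nat} (U : Rn n -> Prop) (f : Rn n -> Rn m) : Prop :=
  forall j, (j < m)%nat -> smooth_on U (fun x => coord (f x) j).

Definition chart_at {n : nat} (x : Rn n) (U : Rn n -> Prop) (phi : Rn n -> Rn n)
  (V : Rn n -> Prop) (psi : Rn n -> Rn n) : Prop :=
  open_set U /\ open_set V /\ U x /\ phi x = Rn0 n /\
  (forall u, U u -> V (phi u)) /\ (forall v, V v -> U (psi v)) /\
  (forall u, U u -> psi (phi u) = u) /\ (forall v, V v -> phi (psi v) = v) /\
  smooth_map_on U phi /\ smooth_map_on V psi.

Definition local_form (g : Rn 4 -> Rn 2) (x : Rn 4) (nf : Rn 4 -> Rn 2) : Prop :=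
  exists U phi V psi U' phi' V' psi' W,
    chart_at x U phi V psi /\ chart_at (g x) U' phi' V' psi' /\
    open_set W /\ W (Rn0 4) /\ (forall u, W u -> V u) /\
    (forall u, W u -> U' (g (psi u))) /\
    (forall u, W u -> phi' (g (psi u)) = nf u).

Definition x1 (u : Rn 4) := coord u 0.
Definition x2 (u : Rn 4) := coord u 1.
Definition x3 (u : Rn 4) := coord u 2.
Definition x4 (u : Rn 4) := coord u 3.

Definition nf_regular (u : Rn 4) : Rn 2 := mk2 (x1 u) (x2 u).
Definition nf_def_fold (u : Rn 4) : Rn 2 :=
  mk2 (x1 u) (x2 u ^ 2 + x3 u ^ 2 + x4 u ^ 2).
Definition nf_indef_fold (u : Rn 4) : Rn 2 :=
  mk2 (x1 u) (x2 u ^ 2 + x3 u ^ 2 - x4 u ^ 2).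
Definition nf_cusp (s : bool) (u : Rn 4) : Rn 2 :=
  mk2 (x1 u) (x2 u ^ 2 + (if s then x3 u ^ 2 else - x3 u ^ 2)
              + x1 u * x4 u + x4 u ^ 3).

Definition is_cusp (g : Rn 4 -> Rn 2) (x : Rn 4) : Prop :=
  exists s, local_form g x (nf_cusp s).

Definition excellent (g : Rn 4 -> Rn 2) : Prop :=
  smooth_map_on (fun _ => True) g /\
  forall x, local_form g x nf_regular \/ local_form g x nf_def_fold \/
            local_form g x nf_indef_fold \/ is_cusp g x.

Definition Cx : Type := (R * R)%type.
Definition Cadd (z w : Cx) : Cx := (fst z + fst w, snd z + snd w).
Definition Cmul (z w : Cx) : Cx :=
  (fst z * fst w - snd z * snd w, fst z * snd w + snd z * fst w).
Fixpoint Cpow (z : Cx) (k : nat) : Cx :=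
  match k with O => (1, 0) | S k' => Cmul z (Cpow z k') end.
Definition Cconj (z : Cx) : Cx := (fst z, - snd z).

Definition Fmap (p q : nat) (a b : Cx) (x : Rn 4) : Rn 2 :=
  let z := (coord x 0, coord x 1) in
  let w := (coord x 2, coord x 3) in
  let r := Cadd (Cadd (Cpow z p) (Cpow w q)) (Cadd (Cmul a (Cconj z)) (Cmul b (Cconj w))) in
  mk2 (fst r) (snd r).

(* Main.v *)
(* A conormal of [F] at a singular point is a complex number [al] with
   [al * p z^(p-1) = - conj (al * a)] and [al * q w^(q-1) = - conj (al * b)]; writing
   [conj al = u * al] with [|u| = 1], the singular points are the solutions of
   [p z^(p-1) = - u conj a], [q w^(q-1) = - u conj b].
   The intrinsic Hessian, the quadratic part of [F] composed with the conormal and restricted to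
   the kernel of the differential, does not depend on coordinates: its radical is trivial at a
   fold and a line at a cusp. For [F] it is the form [Re (P x^2 + Q y^2) / 2] on the kernel of
   [Im (A x + B y)], whose radical is contained in the line spanned by [(- i A / P, - i B / Q)]
   and nontrivial iff [Re (A^2 / P + B^2 / Q) = 0], that is iff [G + u conj G = 0] for
   [G = p (q-1) z^p + q (p-1) w^q].
   If [p zt^(p-1) = - conj a] and [q w0^(q-1) = - conj b], then [z = zt y^(q-1)],
   [w = w0 y^(p-1)], [u = y^((p-1)(q-1))] with [|y| = 1] are singular points; the circles
   obtained from the [p - 1] choices of [zt] cover the singular set [(p - 1)]-to-one. On each of
   them the cusp equation becomes a polynomial equation in [y] of degree [(p-1)(q+1)], not
   satisfied by all [y] because cusps are isolated, and also, with [y = e^(ix)], the vanishing of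
   a sum of two cosines of frequencies at least [(p+1)(q-1)/2]. Hence each circle carries between
   [(p+1)(q-1)] and [(p-1)(q+1)] solutions, and so does the set of cusps. *)
From Stdlib Require Import Reals Lra Lia Arith List FinFun Classical.
From Stdlib Require Import FunctionalExtensionality.
From Coquelicot Require Import Hierarchy Equiv Derive AutoDerive Continuity Rcomplements.
Require Import Defs.
From Coquelicot Require Import Complex.
Open Scope R_scope.

(** * R^n as a normed module *)

Fixpoint sumn (n : nat) (f : nat -> R) : R :=
  match n with O => 0 | S k => sumn k f + f k end.

Lemma sumn_ext (n : nat) (f g : nat -> R) :
  (forall i, (i < n)%nat -> f i = g i) -> sumn n f = sumn n g.
Proof.
  induction n as [|n IH]; intros H; simpl; [reflexivity|].
  rewrite IH, H by auto. reflexivity.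
Qed.

Lemma sumn_le (n : nat) (f g : nat -> R) :
  (forall i, (i < n)%nat -> f i <= g i) -> sumn n f <= sumn n g.
Proof.
  induction n as [|n IH]; intros H; simpl; [lra|].
  apply Rplus_le_compat; auto.
Qed.

Lemma sumn_plus (n : nat) (f g : nat -> R) :
  sumn n (fun i => f i + g i) = sumn n f + sumn n g.
Proof. induction n as [|n IH]; simpl; [ring|rewrite IH; ring]. Qed.

Lemma sumn_scal (n : nat) (c : R) (f : nat -> R) :
  sumn n (fun i => c * f i) = c * sumn n f.
Proof. induction n as [|n IH]; simpl; [ring|rewrite IH; ring]. Qed.

Lemma sumn_const (n : nat) (c : R) : sumn n (fun _ => c) = INR n * c.
Proof. induction n as [|n IH]; [simpl; ring|]. rewrite S_INR; simpl. rewrite IH. ring. Qed.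

Lemma sumn_ge0 (n : nat) (f : nat -> R) :
  (forall i, (i < n)%nat -> 0 <= f i) -> 0 <= sumn n f.
Proof.
  intros H. apply Rle_trans with (sumn n (fun _ => 0)); [rewrite sumn_const; lra|].
  apply sumn_le, H.
Qed.

Lemma sumn_ge_term (n i : nat) (f : nat -> R) :
  (forall j, (j < n)%nat -> 0 <= f j) -> (i < n)%nat -> f i <= sumn n f.
Proof.
  intros H hi. induction n as [|n IH]; [lia|]. simpl.
  pose proof (sumn_ge0 n f (fun j hj => H j (Nat.lt_lt_succ_r _ _ hj))) as hs.
  destruct (Nat.eq_dec i n) as [->|h]; [lra|].
  assert (f i <= sumn n f) by (apply IH; [auto|lia]).
  specialize (H n (Nat.lt_succ_diag_r n)). lra.
Qed.

Lemma Rn_ext (n : nat) (x y : Rn n) :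
  (forall i, (i < n)%nat -> coord x i = coord y i) -> x = y.
Proof.
  destruct x as [x hx], y as [y hy]; unfold coord; simpl; intros H.
  assert (E : x = y).
  { apply functional_extensionality; intros i.
    destruct (le_lt_dec n i) as [h|h]; [rewrite hx, hy by exact h; reflexivity|auto]. }
  subst y. f_equal. apply proof_irrelevance.
Qed.

Definition mkRn (n : nat) (f : nat -> R) : Rn n.
Proof.
  exists (fun i => if (i <? n)%nat then f i else 0).
  intros i hi. destruct (Nat.ltb_spec i n); [lia|reflexivity].
Defined.

Lemma coord_mkRn (n : nat) (f : nat -> R) (i : nat) :
  (i < n)%nat -> coord (mkRn n f) i = f i.
Proof.
  intros h. unfold coord, mkRn; simpl. destruct (Nat.ltb_spec i n); [reflexivity|lia].
Qed.

Lemma coord_upd_same (n : nat) (x : Rn n) (i : nat) (t : R) :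
  (i < n)%nat -> coord (upd x i t) i = t.
Proof.
  intros h. unfold coord, upd; simpl. rewrite Nat.eqb_refl.
  destruct (Nat.ltb_spec i n); [reflexivity|lia].
Qed.

Lemma coord_upd_other (n : nat) (x : Rn n) (i j : nat) (t : R) :
  j <> i -> coord (upd x i t) j = coord x j.
Proof.
  intros h. unfold coord, upd; simpl. destruct (Nat.eqb_spec j i); [lia|reflexivity].
Qed.

Section RnNormedModule.
Context (n : nat).
Implicit Types (x y z : Rn n) (a b : R).

Definition Rn_plus x y : Rn n := mkRn n (fun i => coord x i + coord y i).
Definition Rn_opp x : Rn n := mkRn n (fun i => - coord x i).
Definition Rn_scal a x : Rn n := mkRn n (fun i => a * coord x i).
Definition Rn_norm x : R := sumn n (fun i => Rabs (coord x i)).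

Local Ltac coordwise :=
  intros; apply Rn_ext; intros i hi;
  unfold Rn_plus, Rn_opp, Rn_scal; rewrite ?coord_mkRn by exact hi.

Lemma Rn_plus_comm x y : Rn_plus x y = Rn_plus y x.
Proof. coordwise. ring. Qed.

Lemma Rn_plus_assoc x y z : Rn_plus x (Rn_plus y z) = Rn_plus (Rn_plus x y) z.
Proof. coordwise. ring. Qed.

Lemma Rn_plus_0_r x : Rn_plus x (Rn0 n) = x.
Proof. coordwise. apply Rplus_0_r. Qed.

Lemma Rn_plus_opp_r x : Rn_plus x (Rn_opp x) = Rn0 n.
Proof. coordwise. apply Rplus_opp_r. Qed.

Lemma Rn_scal_assoc a b x : Rn_scal a (Rn_scal b x) = Rn_scal (a * b) x.
Proof. coordwise. ring. Qed.

Lemma Rn_scal_1_l x : Rn_scal 1 x = x.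
Proof. coordwise. ring. Qed.

Lemma Rn_scal_distr_l a x y : Rn_scal a (Rn_plus x y) = Rn_plus (Rn_scal a x) (Rn_scal a y).
Proof. coordwise. ring. Qed.

Lemma Rn_scal_distr_r a b x : Rn_scal (a + b) x = Rn_plus (Rn_scal a x) (Rn_scal b x).
Proof. coordwise. ring. Qed.

Definition Rn_AbelianMonoid_mixin :=
  AbelianMonoid.Mixin (Rn n) Rn_plus (Rn0 n) Rn_plus_comm Rn_plus_assoc Rn_plus_0_r.
Canonical Rn_AbelianMonoid := AbelianMonoid.Pack (Rn n) Rn_AbelianMonoid_mixin (Rn n).

Definition Rn_AbelianGroup_mixin := AbelianGroup.Mixin Rn_AbelianMonoid Rn_opp Rn_plus_opp_r.
Canonical Rn_AbelianGroup :=
  AbelianGroup.Pack (Rn n) (AbelianGroup.Class _ _ Rn_AbelianGroup_mixin) (Rn n).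

Definition Rn_ModuleSpace_mixin := ModuleSpace.Mixin R_Ring Rn_AbelianGroup Rn_scal
  Rn_scal_assoc Rn_scal_1_l Rn_scal_distr_l Rn_scal_distr_r.
Canonical Rn_ModuleSpace :=
  ModuleSpace.Pack R_Ring (Rn n) (ModuleSpace.Class _ _ _ Rn_ModuleSpace_mixin) (Rn n).

Lemma near_center x (e : posreal) : near x x e.
Proof. intros i _. rewrite Rminus_diag, Rabs_R0. apply cond_pos. Qed.

Lemma near_sym x y e : near x y e -> near y x e.
Proof. intros H i hi. rewrite Rabs_minus_sym. apply H, hi. Qed.

Lemma near_triangle x y z e1 e2 : near x y e1 -> near y z e2 -> near x z (e1 + e2).
Proof.
  intros hxy hyz i hi.
  replace (coord z i - coord x i) with ((coord y i - coord x i) + (coord z i - coord y i)) by ring.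
  eapply Rle_lt_trans; [apply Rabs_triang|]. apply Rplus_lt_compat; auto.
Qed.

Definition Rn_UniformSpace_mixin :=
  UniformSpace.Mixin (Rn n) (Rn0 n)
  (fun x e y => near x y e) near_center (fun x y e => near_sym x y e)
  (fun x y z => near_triangle x y z).
Canonical Rn_UniformSpace := UniformSpace.Pack (Rn n) Rn_UniformSpace_mixin (Rn n).

Canonical Rn_NormedModuleAux := NormedModuleAux.Pack R_AbsRing (Rn n)
  (NormedModuleAux.Class R_AbsRing (Rn n)
    (ModuleSpace.class _ Rn_ModuleSpace) (UniformSpace.class Rn_UniformSpace)) (Rn n).

Lemma coord_plus x y (i : nat) : (i < n)%nat -> coord (plus x y) i = coord x i + coord y i.
Proof. apply coord_mkRn. Qed.

Lemma coord_opp x (i : nat) : (i < n)%nat -> coord (opp x) i = - coord x i.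
Proof. apply coord_mkRn. Qed.

Lemma coord_minus x y (i : nat) : (i < n)%nat -> coord (minus x y) i = coord x i - coord y i.
Proof. intros hi. unfold minus. rewrite coord_plus, coord_opp by exact hi. reflexivity. Qed.

Lemma coord_scal a x (i : nat) : (i < n)%nat -> coord (scal a x) i = a * coord x i.
Proof. apply coord_mkRn. Qed.

Lemma Rabs_coord_le_norm x (i : nat) : (i < n)%nat -> Rabs (coord x i) <= Rn_norm x.
Proof.
  apply (sumn_ge_term n i (fun i => Rabs (coord x i))). intros j _. apply Rabs_pos.
Qed.

Lemma Rn_norm_triangle x y : Rn_norm (plus x y) <= Rn_norm x + Rn_norm y.
Proof.
  unfold Rn_norm. rewrite <- sumn_plus. apply sumn_le. intros i hi.
  rewrite coord_plus by exact hi. apply Rabs_triang.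
Qed.

Lemma Rn_norm_scal a x : Rn_norm (scal a x) <= Rabs a * Rn_norm x.
Proof.
  unfold Rn_norm. rewrite <- sumn_scal. apply Req_le, sumn_ext. intros i hi.
  rewrite coord_scal by exact hi. apply Rabs_mult.
Qed.

Lemma Rn_norm_lt_near x y (e : R) : Rn_norm (minus y x) < e -> near x y e.
Proof.
  intros H i hi. rewrite <- coord_minus by exact hi.
  eapply Rle_lt_trans; [apply Rabs_coord_le_norm, hi|exact H].
Qed.

Lemma near_norm_lt x y (e : posreal) : near x y e -> Rn_norm (minus y x) < (INR n + 1) * e.
Proof.
  intros H. apply Rle_lt_trans with (sumn n (fun _ => pos e)).
  - apply sumn_le. intros i hi. rewrite coord_minus by exact hi. apply Rlt_le, H, hi.
  - rewrite sumn_const. pose proof (cond_pos e). lra.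
Qed.

Lemma Rn_norm_eq_0 x : Rn_norm x = 0 -> x = zero.
Proof.
  intros H. apply Rn_ext. intros i hi. change (coord zero i) with 0.
  pose proof (Rabs_coord_le_norm x i hi). pose proof (Rabs_pos (coord x i)).
  destruct (Req_dec (coord x i) 0) as [h|h]; [exact h|].
  pose proof (Rabs_pos_lt _ h). lra.
Qed.

Definition Rn_NormedModule_mixin := NormedModule.Mixin R_AbsRing Rn_NormedModuleAux
  Rn_norm (INR n + 1) Rn_norm_triangle Rn_norm_scal Rn_norm_lt_near near_norm_lt Rn_norm_eq_0.
Canonical Rn_NormedModule := NormedModule.Pack R_AbsRing (Rn n)
  (NormedModule.Class _ _ _ Rn_NormedModule_mixin) (Rn n).

End RnNormedModule.

Lemma is_linear_coord (n i : nat) : (i < n)%nat -> is_linear (fun x : Rn n => coord x i).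
Proof.
  intros hi. split.
  - intros x y. apply coord_plus, hi.
  - intros a x. apply coord_scal, hi.
  - exists 1. split; [lra|]. intros x. rewrite Rmult_1_l. apply (Rabs_coord_le_norm n x i hi).
Qed.

Lemma is_linear_coord_scal (n i : nat) (a : R) :
  (i < n)%nat -> is_linear (fun x : Rn n => a * coord x i).
Proof.
  intros hi. apply is_linear_comp with (1 := is_linear_coord n i hi) (l2 := fun r => a * r).
  apply (is_linear_scal_r (K := R_AbsRing) (V := R_NormedModule)), Rmult_comm.
Qed.

Lemma is_linear_Rplus (U : NormedModule R_AbsRing) (f g : U -> R) :
  is_linear f -> is_linear g -> is_linear (fun u => f u + g u).
Proof.
  intros Hf Hg.
  exact (is_linear_comp _ _ (is_linear_prod f g Hf Hg) (is_linear_plus (V := R_NormedModule))).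
Qed.

Lemma is_linear_sumn (U : NormedModule R_AbsRing) (n : nat) (l : nat -> U -> R) :
  (forall i, (i < n)%nat -> is_linear (l i)) -> is_linear (fun u => sumn n (fun i => l i u)).
Proof.
  induction n as [|n IH]; intros H; simpl; [exact is_linear_zero|].
  apply is_linear_Rplus; auto.
Qed.

Lemma is_linear_coordwise (U : NormedModule R_AbsRing) (n : nat) (L : U -> Rn n) :
  (forall i, (i < n)%nat -> is_linear (fun u => coord (L u) i)) -> is_linear L.
Proof.
  intros H. split.
  - intros u v. apply Rn_ext. intros i hi. rewrite coord_plus by exact hi. apply (H i hi).
  - intros a u. apply Rn_ext. intros i hi. rewrite coord_scal by exact hi. apply (H i hi).
  - assert (bound : forall m, (m <= n)%nat -> exists M, 0 < M /\
      forall u, sumn m (fun i => Rabs (coord (L u) i)) <= M * norm u); [|exact (bound n (le_n n))].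
    induction m as [|m IH]; intros hm.
    + exists 1. split; [lra|]. intros u. simpl. rewrite Rmult_1_l. apply norm_ge_0.
    + destruct IH as [M [hM HM]]; [lia|].
      destruct (linear_norm _ (H m hm)) as [M' [hM' HM']].
      exists (M + M'). split; [lra|]. intros u. simpl. rewrite Rmult_plus_distr_r.
      apply Rplus_le_compat; [apply HM|apply HM'].
Qed.

Lemma filter_forall_lt {T : Type} {F : (T -> Prop) -> Prop} {FF : Filter F}
  (n : nat) (P : nat -> T -> Prop) :
  (forall i, (i < n)%nat -> F (P i)) -> F (fun t => forall i, (i < n)%nat -> P i t).
Proof.
  induction n as [|n IH]; intros H; [apply filter_forall; intros; lia|].
  assert (Hn : F (fun t => forall i, (i < n)%nat -> P i t)) by auto.
  generalize (filter_and _ _ Hn (H n (Nat.lt_succ_diag_r n))). apply filter_imp.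
  intros t [Hlt Hlast] i hi. destruct (Nat.eq_dec i n) as [->|h]; [exact Hlast|apply Hlt; lia].
Qed.

Lemma is_domin_coordwise {T : Type} {F : (T -> Prop) -> Prop} {FF : Filter F}
  {U : NormedModule R_AbsRing} (n : nat) (f : T -> U) (g : T -> Rn n) :
  (forall i, (i < n)%nat -> is_domin F f (fun t => coord (g t) i)) <-> is_domin F f g.
Proof.
  split.
  - intros H eps. pose proof (cond_pos eps) as he. pose proof (pos_INR n) as hn.
    assert (he' : 0 < eps / (INR n + 1)) by (apply Rdiv_lt_0_compat; lra).
    generalize (filter_forall_lt n _ (fun i hi => H i hi (mkposreal _ he'))).
    apply filter_imp. intros t Ht. simpl in Ht.
    apply Rle_trans with (sumn n (fun _ => eps / (INR n + 1) * norm (f t))).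
    + apply sumn_le, Ht.
    + rewrite sumn_const. pose proof (norm_ge_0 (f t)) as hf.
      replace (INR n * (eps / (INR n + 1) * norm (f t)))
        with (eps * norm (f t) - eps / (INR n + 1) * norm (f t)) by (field; lra).
      assert (0 <= eps / (INR n + 1) * norm (f t)) by (apply Rmult_le_pos; lra). lra.
  - intros H i hi. exact (is_domin_linear _ _ _ (is_linear_coord n i hi) H).
Qed.

Lemma filterdiff_coordwise (U : NormedModule R_AbsRing) (F : (U -> Prop) -> Prop) (FF : Filter F)
  (n : nat) (f L : U -> Rn n) :
  (forall i, (i < n)%nat -> filterdiff (fun u => coord (f u) i) F (fun u => coord (L u) i)) ->
  filterdiff f F L.
Proof.
  intros H. split; [apply is_linear_coordwise; intros i hi; apply H, hi|].
  intros x hx. apply is_domin_coordwise. intros i hi eps.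
  generalize (proj2 (H i hi) x hx eps). apply filter_imp. intros u.
  rewrite !coord_minus by exact hi. exact (fun h => h).
Qed.

(** * Second-order expansions along curves *)

Section GroupIdentities.
Context {G : AbelianGroup}.
Implicit Types (x y u v : G).

Lemma minus_plus_plus x y u v : minus (plus x y) (plus u v) = plus (minus x u) (minus y v).
Proof.
  unfold minus. rewrite opp_plus, <- !plus_assoc. f_equal.
  rewrite !plus_assoc, (plus_comm y). reflexivity.
Qed.

Lemma plus_minus_r x y : plus (minus x y) y = x.
Proof. unfold minus. rewrite <- plus_assoc, plus_opp_l. apply plus_zero_r. Qed.

Lemma minus_plus_l x y : minus (plus x y) x = y.
Proof. unfold minus. rewrite plus_comm, plus_assoc, plus_opp_l. apply plus_zero_l. Qed.

Lemma plus_minus_plus_r x u v : plus (minus x (plus u v)) v = minus x u.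
Proof.
  unfold minus. rewrite opp_plus, <- !plus_assoc, plus_opp_l, plus_zero_r. reflexivity.
Qed.

Lemma plus_plus_exchange x y u v : plus (plus x y) (plus u v) = plus (plus x u) (plus y v).
Proof.
  rewrite <- !plus_assoc. f_equal. rewrite !plus_assoc. f_equal. apply plus_comm.
Qed.

End GroupIdentities.

Section ModuleIdentities.
Context {M : ModuleSpace R_Ring}.
Implicit Types (u v x : M) (s t : R).

Lemma plus_scal_zero_l t u : plus (scal t zero) u = u.
Proof. rewrite (scal_zero_r (K := R_Ring)). apply plus_zero_l. Qed.

Lemma minus_scal_zero s t u : minus (minus u u) (plus (scal s zero) (scal t zero)) = zero.
Proof.
  rewrite plus_scal_zero_l, (scal_zero_r (K := R_Ring)).
  rewrite (minus_eq_zero (G := M)). apply (minus_zero_r (G := M)).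
Qed.

Lemma minus_line_increment s t x v :
  minus (minus (plus x (scal t v)) (plus x (scal 0 v))) (plus (scal t v) (scal s zero)) = zero.
Proof.
  rewrite (scal_zero_r (K := R_Ring)), (scal_zero_l (K := R_Ring)), !plus_zero_r.
  rewrite (minus_plus_l (G := M)). apply (minus_eq_zero (G := M)).
Qed.

Lemma minus_plus_increments s t x x' y y' u u' v v' :
  minus (minus (plus x y) (plus x' y')) (plus (scal s (plus u u')) (scal t (plus v v')))
  = plus (minus (minus x x') (plus (scal s u) (scal t v)))
         (minus (minus y y') (plus (scal s u') (scal t v'))).
Proof.
  rewrite !(scal_distr_l (K := R_Ring)), (plus_plus_exchange (G := M)).
  rewrite !(minus_plus_plus (G := M)). reflexivity.
Qed.

End ModuleIdentities.

Lemma norm_scal_eq {V : NormedModule R_AbsRing} (a : R) (v : V) :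
  norm (scal a v) = Rabs a * norm v.
Proof.
  apply Rle_antisym; [exact (norm_scal a v)|].
  destruct (Req_dec a 0) as [->|ha].
  { rewrite Rabs_R0, Rmult_0_l. apply norm_ge_0. }
  pose proof (norm_scal (/ a) (scal a v)) as H.
  rewrite scal_assoc in H. change (mult (/ a) a) with (/ a * a) in H.
  rewrite Rinv_l in H by exact ha. change 1 with (one (K := R_Ring)) in H. rewrite scal_one in H.
  change (abs (/ a)) with (Rabs (/ a)) in H. rewrite Rabs_inv in H.
  pose proof (Rabs_pos_lt a ha) as hp.
  apply (Rmult_le_compat_l (Rabs a)) in H; [|lra].
  rewrite <- Rmult_assoc, Rinv_r, Rmult_1_l in H by lra. exact H.
Qed.

Section LittleO.
Context {V : NormedModule R_AbsRing}.
Implicit Types (f g : R -> V) (l : V).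

Definition o_pow (k : nat) f : Prop :=
  is_domin (U := R_NormedModule) (locally 0) (fun t : R => t ^ k) f.

Lemma o_pow_ext_loc (k : nat) f g :
  locally 0 (fun t => f t = g t) -> o_pow k f -> o_pow k g.
Proof.
  intros E H eps. generalize (filter_and _ _ E (H eps)). apply filter_imp.
  intros t [<- h]. exact h.
Qed.

Lemma o_pow_ext (k : nat) f g : (forall t, f t = g t) -> o_pow k f -> o_pow k g.
Proof. intros E. apply o_pow_ext_loc, filter_forall, E. Qed.

Lemma o_pow_zero (k : nat) : o_pow k (fun _ => zero).
Proof.
  intros eps. apply filter_forall. intros t. rewrite norm_zero.
  apply Rmult_le_pos; [apply Rlt_le, cond_pos|apply norm_ge_0].
Qed.

Lemma o_pow_plus (k : nat) f g : o_pow k f -> o_pow k g -> o_pow k (fun t => plus (f t) (g t)).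
Proof. exact (domin_plus _ _ _). Qed.

Lemma o_pow_lt (j k : nat) l : (j < k)%nat -> o_pow j (fun t => scal (t ^ k) l).
Proof.
  intros hjk eps.
  assert (he : 0 < Rmin 1 (eps / (norm l + 1))).
  { pose proof (norm_ge_0 l). apply Rmin_glb_lt; [lra|].
    apply Rdiv_lt_0_compat; [apply cond_pos|lra]. }
  exists (mkposreal _ he). intros t ht. change (Rabs (t - 0) < Rmin 1 (eps / (norm l + 1))) in ht.
  rewrite Rminus_0_r in ht. pose proof (norm_ge_0 l) as hl. pose proof (Rabs_pos t) as ht0.
  assert (t_le_1 : Rabs t <= 1) by (pose proof (Rmin_l 1 (eps / (norm l + 1))); lra).
  assert (t_le_eps : Rabs t * (norm l + 1) <= eps).
  { apply Rle_div_r; [lra|]. pose proof (Rmin_r 1 (eps / (norm l + 1))). lra. }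
  rewrite norm_scal_eq. change (Rabs (t ^ k) * norm l <= eps * Rabs (t ^ j)).
  replace k with (S (k - S j) + j)%nat by lia. rewrite pow_add, Rabs_mult. simpl.
  rewrite Rabs_mult.
  assert (pow_le_1 : Rabs (t ^ (k - S j)) <= 1).
  { rewrite <- RPow_abs, <- (pow1 (k - S j)). apply pow_incr. lra. }
  pose proof (Rabs_pos (t ^ j)) as hj. pose proof (Rabs_pos (t ^ (k - S j))) as hk.
  replace (Rabs t * Rabs (t ^ (k - S j)) * Rabs (t ^ j) * norm l)
    with (Rabs (t ^ (k - S j)) * (Rabs t * norm l) * Rabs (t ^ j)) by ring.
  apply Rmult_le_compat_r; [exact hj|].
  apply Rle_trans with (1 * (Rabs t * norm l)); [|lra].
  apply Rmult_le_compat_r; [apply Rmult_le_pos; lra|exact pow_le_1].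
Qed.

Lemma o_pow_monomial_eq0 (k : nat) l : o_pow k (fun t => scal (t ^ k) l) -> l = zero.
Proof.
  intros H. apply norm_eq_zero. destruct (norm_ge_0 l) as [hl|hl]; [exfalso|auto].
  assert (he : 0 < norm l / 2) by lra.
  destruct (H (mkposreal _ he)) as [d Hd]. pose proof (cond_pos d) as hd.
  assert (hb : ball 0 d (d / 2)).
  { change (Rabs (d / 2 - 0) < d). rewrite Rminus_0_r, Rabs_pos_eq; lra. }
  specialize (Hd _ hb). rewrite norm_scal_eq in Hd.
  change (Rabs ((d / 2) ^ k) * norm l <= norm l / 2 * Rabs ((d / 2) ^ k)) in Hd.
  assert (hp : 0 < Rabs ((d / 2) ^ k)) by (apply Rabs_pos_lt, pow_nonzero; lra).
  nra.
Qed.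

End LittleO.

Section LeadingTerms.
Context {V : NormedModule R_AbsRing}.
Implicit Types (c f g : R -> V) (a b l : V).

Definition leading_term (k : nat) c l : Prop :=
  o_pow k (fun t => minus (minus (c t) (c 0)) (scal (t ^ k) l)).

Definition taylor2 c a b : Prop :=
  o_pow 2 (fun t => minus (minus (c t) (c 0)) (plus (scal t a) (scal (t ^ 2) b))).

Lemma leading_term_unique (k : nat) c l l' :
  leading_term k c l -> leading_term k c l' -> l = l'.
Proof.
  intros H H'. assert (E : minus l l' = zero).
  { apply (o_pow_monomial_eq0 k).
    apply o_pow_ext with (f := fun t => plus (minus (minus (c t) (c 0)) (scal (t ^ k) l'))
      (scal (opp one) (minus (minus (c t) (c 0)) (scal (t ^ k) l)))).
    - intros t. rewrite scal_opp_one, opp_minus, plus_comm.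
      transitivity (minus (scal (t ^ k) l) (scal (t ^ k) l')); symmetry.
      + apply (minus_trans (G := V)).
      + apply (scal_minus_distr_l (V := V)).
    - apply o_pow_plus; [exact H'|apply domin_scal_r, H]. }
  apply (plus_reg_r (opp l')). rewrite plus_opp_r. exact E.
Qed.

Lemma leading_term_ext_loc (k : nat) f g l :
  locally 0 (fun t => f t = g t) -> leading_term k f l -> leading_term k g l.
Proof.
  intros E. apply o_pow_ext_loc. rewrite <- (locally_singleton _ _ E).
  revert E. apply filter_imp. intros t <-. reflexivity.
Qed.

Lemma taylor2_ext f g a b a' b' :
  (forall t, f t = g t) -> a = a' -> b = b' -> taylor2 f a b -> taylor2 g a' b'.
Proof. intros E <- <-. apply o_pow_ext. intros t. rewrite !E. reflexivity. Qed.

Lemma taylor2_leading_term_1 c a b : taylor2 c a b -> leading_term 1 c a.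
Proof.
  intros H. apply o_pow_ext with (f := fun t =>
    plus (minus (minus (c t) (c 0)) (plus (scal t a) (scal (t ^ 2) b))) (scal (t ^ 2) b)).
  - intros t. rewrite pow_1. apply (plus_minus_plus_r (G := V)).
  - apply o_pow_plus; [|apply o_pow_lt; lia].
    apply domin_trans with (2 := H). intros eps.
    generalize (o_pow_lt (V := R_NormedModule) 1 2 1 ltac:(lia) eps). apply filter_imp.
    intros t. unfold scal; simpl; unfold mult; simpl. rewrite !Rmult_1_r. exact (fun h => h).
Qed.

Lemma taylor2_leading_term_2 c b : taylor2 c zero b -> leading_term 2 c b.
Proof.
  apply o_pow_ext. intros t. f_equal. apply (plus_scal_zero_l (M := V)).
Qed.

Lemma taylor2_const l : taylor2 (fun _ => l) zero zero.
Proof.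
  apply o_pow_ext with (2 := o_pow_zero 2). intros t.
  symmetry. apply (minus_scal_zero (M := V)).
Qed.

Lemma taylor2_plus f g a b a' b' :
  taylor2 f a b -> taylor2 g a' b' ->
  taylor2 (fun t => plus (f t) (g t)) (plus a a') (plus b b').
Proof.
  intros H H'. refine (o_pow_ext 2 _ _ _ (o_pow_plus 2 _ _ H H')). intros t.
  symmetry. apply (minus_plus_increments (M := V)).
Qed.

Lemma taylor2_line l a : taylor2 (fun t => plus l (scal t a)) a zero.
Proof.
  apply o_pow_ext with (2 := o_pow_zero 2). intros t.
  symmetry. apply (minus_line_increment (M := V)).
Qed.

Lemma leading_term_bound (k : nat) c l : leading_term k c l ->
  locally 0 (fun t => norm (minus (c t) (c 0)) <= (norm l + 1) * Rabs (t ^ k)).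
Proof.
  intros H. generalize (H (mkposreal 1 Rlt_0_1)). apply filter_imp. intros t Ht. simpl in Ht.
  rewrite Rmult_1_l in Ht. change (norm (t ^ k)) with (Rabs (t ^ k)) in Ht.
  replace (minus (c t) (c 0))
    with (plus (minus (minus (c t) (c 0)) (scal (t ^ k) l)) (scal (t ^ k) l)).
  - eapply Rle_trans; [apply norm_triangle|]. rewrite norm_scal_eq.
    change (abs (t ^ k)) with (Rabs (t ^ k)). lra.
  - apply (plus_minus_r (G := V)).
Qed.

Lemma leading_term_continuous (k : nat) c l : (1 <= k)%nat -> leading_term k c l ->
  continuous c 0.
Proof.
  intros hk H. apply filterlim_locally. intros eps.
  pose proof (norm_ge_0 l) as hl.
  assert (he : 0 < eps / (norm l + 2)) by (apply Rdiv_lt_0_compat; [apply cond_pos|lra]).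
  generalize (filter_and _ _ (leading_term_bound k c l H)
    (o_pow_lt (V := R_NormedModule) 0 k 1 hk (mkposreal _ he))).
  apply filter_imp. intros t [increment_bound pow_bound]. apply norm_compat1.
  eapply Rle_lt_trans; [exact increment_bound|]. rewrite norm_scal_eq in pow_bound.
  change (Rabs (t ^ k) * Rabs 1 <= eps / (norm l + 2) * Rabs 1) in pow_bound.
  rewrite Rabs_R1, !Rmult_1_r in pow_bound.
  apply Rle_lt_trans with ((norm l + 1) * (eps / (norm l + 2))); [apply Rmult_le_compat_l; lra|].
  replace ((norm l + 1) * (eps / (norm l + 2))) with (eps - eps / (norm l + 2)) by (field; lra).
  lra.
Qed.

End LeadingTerms.

Lemma taylor2_linear {V W : NormedModule R_AbsRing} (L : V -> W) (c : R -> V) (a b : V) :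
  is_linear L -> taylor2 c a b -> taylor2 (fun t => L (c t)) (L a) (L b).
Proof.
  intros HL H. refine (o_pow_ext 2 _ _ _ (is_domin_linear _ _ L HL H)). intros t.
  rewrite !(linear_minus L _ _ HL), (linear_plus L HL), !(linear_scal L HL). reflexivity.
Qed.

Lemma leading_term_comp {V W : NormedModule R_AbsRing} (k : nat) (f : V -> W) (c : R -> V)
  (L : V -> W) (l : V) :
  (1 <= k)%nat -> filterdiff f (locally (c 0)) L -> leading_term k c l ->
  leading_term k (fun t => f (c t)) (L l).
Proof.
  intros hk [HL Hf] Hc.
  apply o_pow_ext with (f := fun t =>
    plus (minus (minus (f (c t)) (f (c 0))) (L (minus (c t) (c 0))))
         (L (minus (minus (c t) (c 0)) (scal (t ^ k) l)))).
  - intros t. rewrite (linear_minus L _ (scal (t ^ k) l) HL), (linear_scal L HL).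
    symmetry. apply (minus_trans (G := W)).
  - apply o_pow_plus; [|exact (is_domin_linear _ _ L HL Hc)].
    intros eps. pose proof (cond_pos eps) as he. pose proof (norm_ge_0 l) as hl.
    assert (he' : 0 < eps / (norm l + 1)) by (apply Rdiv_lt_0_compat; lra).
    generalize (filter_and _ _ (leading_term_bound k c l Hc)
      (leading_term_continuous k c l hk Hc _
        (Hf (c 0) (fun P h => h) (mkposreal _ he')))).
    apply filter_imp. intros t [curve_bound remainder_bound].
    eapply Rle_trans; [exact remainder_bound|]. simpl.
    replace (eps * norm (t ^ k)) with (eps / (norm l + 1) * ((norm l + 1) * Rabs (t ^ k))).
    + apply Rmult_le_compat_l; lra.
    + change (norm (t ^ k)) with (Rabs (t ^ k)). field. lra.
Qed.

Lemma taylor2_coordwise (n : nat) (c : R -> Rn n) (a b : Rn n) :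
  (forall i, (i < n)%nat -> taylor2 (fun t => coord (c t) i) (coord a i) (coord b i)) <->
  taylor2 c a b.
Proof.
  split.
  - intros H. apply is_domin_coordwise. intros i hi. refine (o_pow_ext 2 _ _ _ (H i hi)).
    intros t. rewrite !coord_minus, coord_plus, !coord_scal by exact hi. reflexivity.
  - intros H i hi. exact (taylor2_linear _ _ _ _ (is_linear_coord n i hi) H).
Qed.

Lemma o_pow_mult_continuous (k : nat) (f g : R -> R) :
  o_pow k f -> continuous g 0 -> o_pow k (fun t => f t * g t).
Proof.
  intros Hf Hg eps. pose proof (cond_pos eps) as he. pose proof (Rabs_pos (g 0)) as hg0.
  assert (he' : 0 < eps / (Rabs (g 0) + 1)) by (apply Rdiv_lt_0_compat; lra).
  generalize (filter_and _ _ (Hf (mkposreal _ he'))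
    (proj1 (filterlim_locally g (g 0)) Hg (mkposreal 1 Rlt_0_1))).
  apply filter_imp. intros t [f_small g_near].
  change (Rabs (f t) <= eps / (Rabs (g 0) + 1) * Rabs (t ^ k)) in f_small.
  change (Rabs (g t - g 0) < 1) in g_near.
  change (Rabs (f t * g t) <= eps * Rabs (t ^ k)). rewrite Rabs_mult.
  replace (eps * Rabs (t ^ k))
    with (eps / (Rabs (g 0) + 1) * Rabs (t ^ k) * (Rabs (g 0) + 1)) by (field; lra).
  apply Rmult_le_compat; try apply Rabs_pos; [exact f_small|].
  pose proof (Rabs_triang_inv (g t) (g 0)). lra.
Qed.

Lemma taylor2_mult (f g : R -> R) (a b a' b' : R) :
  taylor2 f a b -> taylor2 g a' b' ->
  taylor2 (fun t => f t * g t) (a * g 0 + f 0 * a') (b * g 0 + a * a' + f 0 * b').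
Proof.
  intros Hf Hg.
  apply o_pow_ext with (f := fun t =>
    plus (minus (minus (f t) (f 0)) (plus (scal t a) (scal (t ^ 2) b)) * g t)
      (plus (minus (minus (g t) (g 0)) (plus (scal t a') (scal (t ^ 2) b'))
               * (f 0 + a * t + b * t ^ 2))
            (scal (t ^ 3) 1 * (a * b' + b * a' + b * b' * t)))).
  { intros t. unfold minus, plus, opp, scal; simpl; unfold mult; simpl. ring. }
  apply (o_pow_plus (V := R_NormedModule)); [|apply (o_pow_plus (V := R_NormedModule))];
    apply o_pow_mult_continuous.
  - exact Hf.
  - exact (leading_term_continuous 1 g a' (le_n 1) (taylor2_leading_term_1 g a' b' Hg)).
  - exact Hg.
  - apply (ex_derive_continuous (V := R_NormedModule)). auto_derive. exact I.
  - apply (o_pow_lt (V := R_NormedModule)). lia.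
  - apply (ex_derive_continuous (V := R_NormedModule)). auto_derive. exact I.
Qed.

Lemma taylor2_scal (f : R -> R) (a b k : R) :
  taylor2 f a b -> taylor2 (fun t => k * f t) (k * a) (k * b).
Proof.
  apply (taylor2_linear (fun r : R => k * r)).
  apply (is_linear_scal_r (K := R_AbsRing) (V := R_NormedModule)), Rmult_comm.
Qed.

(* Peano's form of Taylor's formula; the mean value theorem is applied to
   [h s - h' 0 s - b/2 s^2], whose derivative is [o(s)]. *)
Lemma taylor2_of_is_derive (h h' : R -> R) (b : R) :
  locally 0 (fun t => is_derive h t (h' t)) -> is_derive h' 0 b -> taylor2 h (h' 0) (b / 2).
Proof.
  intros Hh [_ Hh'] eps.
  destruct (filter_and _ _ Hh (Hh' 0 (fun P hP => hP) eps)) as [d Hd].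
  exists d. intros t ht.
  assert (Hs : forall s, Rabs (s - 0) <= Rabs t -> is_derive h s (h' s) /\
    Rabs (h' s - h' 0 - b * s) <= eps * Rabs s).
  { intros s hs. destruct (Hd s) as [deriv_h deriv_h'_bound].
    - change (Rabs (t - 0) < d) in ht. rewrite Rminus_0_r in ht.
      eapply Rle_lt_trans; [exact hs|exact ht].
    - split; [exact deriv_h|].
      change (Rabs (h' s - h' 0 - (s - 0) * b) <= eps * Rabs (s - 0)) in deriv_h'_bound.
      rewrite Rminus_0_r, (Rmult_comm s) in deriv_h'_bound. exact deriv_h'_bound. }
  destruct (MVT_cor4 (fun s => h s - h' 0 * s - b / 2 * s ^ 2) (fun s => h' s - h' 0 - b * s)
    0 (Rabs t)) with (b := t) as [s [E hs]].
  - intros s hs. destruct (Hs s hs) as [deriv_h _]. auto_derive.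
    + exists (h' s). exact deriv_h.
    + rewrite (is_derive_unique (fun r : R => h r) s _ deriv_h). field.
  - rewrite Rminus_0_r. apply Rle_refl.
  - rewrite (Rminus_0_r t) in hs. destruct (Hs s hs) as [_ deriv_h'_bound].
    rewrite Rminus_0_r in hs, E.
    change (Rabs (h t - h 0 - (t * h' 0 + t ^ 2 * (b / 2))) <= eps * Rabs (t ^ 2)).
    replace (h t - h 0 - (t * h' 0 + t ^ 2 * (b / 2))) with ((h' s - h' 0 - b * s) * t)
      by (rewrite <- E; ring).
    rewrite Rabs_mult, <- RPow_abs. simpl. rewrite Rmult_1_r, <- Rmult_assoc.
    apply Rmult_le_compat_r; [apply Rabs_pos|].
    eapply Rle_trans; [exact deriv_h'_bound|].
    apply Rmult_le_compat_l; [apply Rlt_le, cond_pos|exact hs].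
Qed.

Lemma open_set_locally (n : nat) (U : Rn n -> Prop) (x : Rn n) :
  open_set U -> U x -> locally x U.
Proof. intros hU hx. destruct (hU x hx) as [e [he He]]. exists (mkposreal e he). exact He. Qed.

Lemma continuous_on_open_set (n : nat) (U : Rn n -> Prop) (f : Rn n -> R) (x : Rn n) :
  open_set U -> U x -> continuous_on U f -> continuous f x.
Proof.
  intros hU hx Hf. apply filterlim_locally. intros eps.
  destruct (Hf x hx eps (cond_pos eps)) as [d [hd Hd]].
  assert (Hn : locally x (fun y => near x y d)) by (exists (mkposreal d hd); auto).
  generalize (filter_and _ _ (open_set_locally n U x hU hx) Hn). apply filter_imp.
  intros y [hUy hy]. exact (Hd y hUy hy).
Qed.

Lemma upd_upd (n : nat) (x : Rn n) (i : nat) (s t : R) : upd (upd x i s) i t = upd x i t.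
Proof.
  apply Rn_ext. intros j hj. destruct (Nat.eq_dec j i) as [->|h].
  - rewrite !coord_upd_same by exact hj. reflexivity.
  - rewrite !coord_upd_other by exact h. reflexivity.
Qed.

Definition hybrid {n : nat} (x y : Rn n) (k : nat) : Rn n :=
  mkRn n (fun i => if (i <? k)%nat then coord y i else coord x i).

Lemma hybrid_0 (n : nat) (x y : Rn n) : hybrid x y 0 = x.
Proof. apply Rn_ext. intros i hi. unfold hybrid. rewrite coord_mkRn by exact hi. reflexivity. Qed.

Lemma hybrid_full (n : nat) (x y : Rn n) : hybrid x y n = y.
Proof.
  apply Rn_ext. intros i hi. unfold hybrid. rewrite coord_mkRn by exact hi.
  destruct (Nat.ltb_spec i n); [reflexivity|lia].
Qed.

Lemma upd_hybrid_old (n : nat) (x y : Rn n) (k : nat) : (k < n)%nat ->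
  upd (hybrid x y k) k (coord x k) = hybrid x y k.
Proof.
  intros hk. apply Rn_ext. intros i hi. destruct (Nat.eq_dec i k) as [->|h].
  - rewrite coord_upd_same by exact hi. unfold hybrid. rewrite coord_mkRn by exact hi.
    rewrite Nat.ltb_irrefl. reflexivity.
  - rewrite coord_upd_other by exact h. reflexivity.
Qed.

Lemma upd_hybrid_new (n : nat) (x y : Rn n) (k : nat) : (k < n)%nat ->
  upd (hybrid x y k) k (coord y k) = hybrid x y (S k).
Proof.
  intros hk. apply Rn_ext. intros i hi. unfold hybrid. destruct (Nat.eq_dec i k) as [->|h].
  - rewrite coord_upd_same, coord_mkRn by exact hi.
    destruct (Nat.ltb_spec k (S k)); [reflexivity|lia].
  - rewrite coord_upd_other, !coord_mkRn by assumption.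
    destruct (Nat.ltb_spec i k), (Nat.ltb_spec i (S k)); try lia; reflexivity.
Qed.

Definition in_box {n : nat} (x y z : Rn n) : Prop :=
  forall i, (i < n)%nat -> Rabs (coord z i - coord x i) <= Rabs (coord y i - coord x i).

Lemma in_box_near (n : nat) (x y z : Rn n) (e : R) : near x y e -> in_box x y z -> near x z e.
Proof. intros hy hz i hi. eapply Rle_lt_trans; [apply hz, hi|apply hy, hi]. Qed.

Lemma in_box_upd_hybrid (n : nat) (x y : Rn n) (k : nat) (s : R) :
  Rabs (s - coord x k) <= Rabs (coord y k - coord x k) -> in_box x y (upd (hybrid x y k) k s).
Proof.
  intros hs i hi. destruct (Nat.eq_dec i k) as [->|h].
  - rewrite coord_upd_same by exact hi. exact hs.
  - rewrite coord_upd_other by exact h. unfold hybrid. rewrite coord_mkRn by exact hi.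
    destruct (i <? k)%nat; [apply Rle_refl|].
    rewrite Rminus_diag, Rabs_R0. apply Rabs_pos.
Qed.

(* From [x] to [y] one coordinate at a time, along the edges of the box. *)
Lemma partials_mean_value_bound (n : nat) (f : Rn n -> R) (g : nat -> Rn n -> R) (l : nat -> R)
  (x y : Rn n) (e : R) :
  (forall i z, (i < n)%nat -> in_box x y z ->
     is_derive (fun t => f (upd z i t)) (coord z i) (g i z) /\ Rabs (g i z - l i) <= e) ->
  Rabs (f y - f x - sumn n (fun i => l i * (coord y i - coord x i)))
    <= e * sumn n (fun i => Rabs (coord y i - coord x i)).
Proof.
  intros H.
  assert (step : forall k, (k < n)%nat ->
    Rabs (f (hybrid x y (S k)) - f (hybrid x y k) - l k * (coord y k - coord x k))
      <= e * Rabs (coord y k - coord x k)).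
  { intros k hk.
    destruct (MVT_cor4 (fun t => f (upd (hybrid x y k) k t))
      (fun t => g k (upd (hybrid x y k) k t)) (coord x k) (Rabs (coord y k - coord x k)))
      with (b := coord y k) as [s [E hs]]; [|apply Rle_refl|].
    - intros s hs. destruct (H k _ hk (in_box_upd_hybrid n x y k s hs)) as [Hd _].
      rewrite coord_upd_same in Hd by exact hk.
      revert Hd. apply is_derive_ext. intros t. rewrite upd_upd. reflexivity.
    - rewrite upd_hybrid_old, upd_hybrid_new in E by exact hk. rewrite E, <- Rmult_minus_distr_r.
      rewrite Rabs_mult. apply Rmult_le_compat_r; [apply Rabs_pos|].
      apply H, in_box_upd_hybrid; assumption. }
  assert (path : forall k, (k <= n)%nat ->
    Rabs (f (hybrid x y k) - f x - sumn k (fun i => l i * (coord y i - coord x i)))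
      <= e * sumn k (fun i => Rabs (coord y i - coord x i))).
  { induction k as [|k IH]; intros hk; simpl.
    - rewrite hybrid_0, Rminus_diag, Rminus_0_r, Rabs_R0. lra.
    - specialize (IH ltac:(lia)). specialize (step k hk). rewrite Rmult_plus_distr_l.
      eapply Rle_trans; [|apply (Rplus_le_compat _ _ _ _ IH step)].
      eapply Rle_trans; [|apply Rabs_triang]. apply Req_le. f_equal. ring. }
  specialize (path n (le_n n)). rewrite hybrid_full in path. exact path.
Qed.

Lemma C1_filterdiff (n : nat) (U : Rn n -> Prop) (f : Rn n -> R) (g : nat -> Rn n -> R) (x : Rn n) :
  open_set U -> U x ->
  (forall i, (i < n)%nat -> has_partial U f i (g i)) ->
  (forall i, (i < n)%nat -> continuous_on U (g i)) ->
  filterdiff f (locally x) (fun v => sumn n (fun i => g i x * coord v i)).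
Proof.
  intros hU hx Hg Hc. split.
  { apply is_linear_sumn with (l := fun i v => g i x * coord v i). intros i hi.
    apply is_linear_coord_scal, hi. }
  intros x' hx' eps. rewrite <- (is_filter_lim_locally_unique _ _ hx'). clear x' hx'.
  assert (Hn : locally x (fun y => forall i, (i < n)%nat -> Rabs (g i y - g i x) < eps)).
  { apply filter_forall_lt. intros i hi.
    exact (proj1 (filterlim_locally _ _) (continuous_on_open_set n U _ x hU hx (Hc i hi)) eps). }
  destruct (filter_and _ _ (open_set_locally n U x hU hx) Hn) as [d Hd].
  exists d. intros y hy.
  apply Rle_trans with (eps * sumn n (fun i => Rabs (coord y i - coord x i))).
  - rewrite (sumn_ext n _ (fun i => g i x * (coord y i - coord x i)))
      by (intros i hi; rewrite coord_minus by exact hi; reflexivity).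
    apply (partials_mean_value_bound n f g). intros i z hi hz.
    destruct (Hd z (in_box_near n x y z d hy hz)) as [hUz hzg]. split.
    + apply is_derive_Reals, Hg; assumption.
    + apply Rlt_le, hzg, hi.
  - apply Req_le. f_equal. apply sumn_ext. intros i hi.
    rewrite coord_minus by exact hi. reflexivity.
Qed.

(** * Jets and the intrinsic Hessian *)

Lemma finite_choice {A : Type} (n : nat) (P : nat -> A -> Prop) (default : A) :
  (forall i, (i < n)%nat -> exists y, P i y) ->
  exists f : nat -> A, forall i, (i < n)%nat -> P i (f i).
Proof.
  induction n as [|n IH]; intros H; [exists (fun _ => default); intros; lia|].
  destruct IH as [f Hf]; [auto|]. destruct (H n (Nat.lt_succ_diag_r n)) as [y Hy].
  exists (fun i => if (i =? n)%nat then y else f i). intros i hi.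
  destruct (Nat.eqb_spec i n) as [->|h]; [exact Hy|apply Hf; lia].
Qed.

Lemma ex_derive_sumn (n : nat) (f : nat -> R -> R) (t : R) :
  (forall i, (i < n)%nat -> ex_derive (f i) t) -> ex_derive (fun s => sumn n (fun i => f i s)) t.
Proof.
  induction n as [|n IH]; intros H; simpl; [apply ex_derive_const|].
  apply (ex_derive_plus (V := R_NormedModule)); auto.
Qed.

Definition line {V : NormedModule R_AbsRing} (x v : V) (t : R) : V := plus x (scal t v).

Lemma line_0 {V : NormedModule R_AbsRing} (x v : V) : line x v 0 = x.
Proof. unfold line. rewrite (scal_zero_l (K := R_Ring)). apply plus_zero_r. Qed.

Lemma locally_line {V : NormedModule R_AbsRing} (x v : V) (P : V -> Prop) :
  locally x P -> locally 0 (fun t => P (line x v t)).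
Proof.
  intros H. apply (leading_term_continuous 1 (line x v) v (le_n 1)).
  - exact (taylor2_leading_term_1 _ _ _ (taylor2_line x v)).
  - rewrite line_0. exact H.
Qed.

Lemma is_derive_line {V W : NormedModule R_AbsRing} (f : V -> W) (x v : V) (t : R) (L : V -> W) :
  filterdiff f (locally (line x v t)) L -> is_derive (fun s => f (line x v s)) t (L v).
Proof.
  intros Hf.
  assert (Hl : is_derive (line x v) t v).
  { replace v with (plus zero (scal one v)) at 2.
    - apply is_derive_plus; [apply is_derive_const|].
      apply (is_derive_scal_l (fun s : R => s)), is_derive_id.
    - rewrite scal_one. apply plus_zero_l. }
  apply (filterdiff_ext_lin _ _ _ (filterdiff_comp' _ _ _ _ _ Hl Hf)).
  intros s. apply (linear_scal L (proj1 Hf)).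
Qed.

Lemma Ck_partials (k n : nat) (U : Rn n -> Prop) (f : Rn n -> R) : Ck (S k) U f ->
  exists g : nat -> Rn n -> R, forall i, (i < n)%nat -> has_partial U f i (g i) /\ Ck k U (g i).
Proof. intros [_ H]. exact (finite_choice n _ (fun _ => 0) H). Qed.

Lemma Ck_continuous_on (k n : nat) (U : Rn n -> Prop) (f : Rn n -> R) :
  Ck k U f -> continuous_on U f.
Proof. destruct k; [exact (fun h => h)|intros [h _]; exact h]. Qed.

Definition diff2 {V W : NormedModule R_AbsRing} (f : V -> W) (x : V) (L : V -> W) : Prop :=
  filterdiff f (locally x) L /\
  forall v, exists w, taylor2 (fun t => f (line x v t)) (L v) w.

Lemma C2_diff2 (n : nat) (U : Rn n -> Prop) (f : Rn n -> R) (x : Rn n) :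
  open_set U -> U x -> Ck 2 U f -> exists L, diff2 f x L.
Proof.
  intros hU hx Hf. destruct (Ck_partials _ _ _ _ Hf) as [g Hg].
  assert (Df : forall y, U y ->
    filterdiff f (locally y) (fun v => sumn n (fun i => g i y * coord v i))).
  { intros y hy. apply (C1_filterdiff n U f g y hU hy); intros i hi; [apply Hg, hi|].
    apply (Ck_continuous_on 1), Hg, hi. }
  assert (Dg : forall i, (i < n)%nat -> ex_filterdiff (g i) (locally x)).
  { intros i hi. destruct (Ck_partials _ _ _ _ (proj2 (Hg i hi))) as [gi Hgi].
    eexists. apply (C1_filterdiff n U (g i) gi x hU hx); intros j hj; apply Hgi, hj. }
  exists (fun v => sumn n (fun i => g i x * coord v i)). split; [apply Df, hx|]. intros v.
  assert (Hd : ex_derive (fun t => sumn n (fun i => g i (line x v t) * coord v i)) 0).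
  { apply ex_derive_sumn with (f := fun i t => g i (line x v t) * coord v i). intros i hi.
    destruct (Dg i hi) as [L HL]. rewrite <- (line_0 x v) in HL.
    apply (ex_derive_scal_l (fun t => g i (line x v t)) 0 (coord v i)).
    exists (L v). apply is_derive_line, HL. }
  destruct Hd as [b Hb]. exists (b / 2).
  replace (sumn n (fun i => g i x * coord v i))
    with (sumn n (fun i => g i (line x v 0) * coord v i)) by (rewrite line_0; reflexivity).
  apply (taylor2_of_is_derive _ (fun t => sumn n (fun i => g i (line x v t) * coord v i)));
    [|exact Hb].
  generalize (locally_line x v _ (open_set_locally n U x hU hx)). apply filter_imp.
  intros t ht. exact (is_derive_line f x v t _ (Df _ ht)).
Qed.

Lemma smooth_map_diff2 (n m : nat) (U : Rn n -> Prop) (f : Rn n -> Rn m) (x : Rn n) :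
  open_set U -> U x -> smooth_map_on U f -> exists L, diff2 f x L.
Proof.
  intros hU hx Hf.
  destruct (finite_choice m (fun i l => diff2 (fun y => coord (f y) i) x l) (fun _ => 0))
    as [l Hl].
  { intros i hi. exact (C2_diff2 n U _ x hU hx (Hf i hi 2%nat)). }
  exists (fun v => mkRn m (fun i => l i v)). split.
  - apply filterdiff_coordwise; [apply locally_filter|]. intros i hi.
    apply (filterdiff_ext_lin _ _ _ (proj1 (Hl i hi))). intros v.
    rewrite coord_mkRn by exact hi. reflexivity.
  - intros v. destruct (finite_choice m
      (fun i b => taylor2 (fun t => coord (f (line x v t)) i) (l i v) b) 0) as [w Hw].
    { intros i hi. apply Hl, hi. }
    exists (mkRn m w). apply taylor2_coordwise. intros i hi.
    rewrite !coord_mkRn by exact hi. apply Hw, hi.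
Qed.

Lemma filterdiff_inverse {V W : NormedModule R_AbsRing} (f : V -> W) (g : W -> V) (x : V)
  (A : V -> W) (B : W -> V) :
  locally x (fun y => g (f y) = y) ->
  filterdiff f (locally x) A -> filterdiff g (locally (f x)) B -> forall v, B (A v) = v.
Proof.
  intros Hgf HA HB v.
  assert (Hl : leading_term 1 (line x v) v)
    by exact (taylor2_leading_term_1 _ _ _ (taylor2_line x v)).
  apply (leading_term_unique 1 (line x v)); [|exact Hl].
  apply leading_term_ext_loc with (f := fun t => g (f (line x v t))).
  - exact (locally_line x v _ Hgf).
  - apply (leading_term_comp 1 g (fun t => f (line x v t))); [lia|rewrite line_0; exact HB|].
    apply (leading_term_comp 1 f); [lia|rewrite line_0; exact HA|exact Hl].
Qed.

Record linear_iso {V : NormedModule R_AbsRing} (L M : V -> V) : Prop := {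
  iso_linear : is_linear L;
  iso_inv_linear : is_linear M;
  iso_cancel : forall v, M (L v) = v;
  iso_inv_cancel : forall v, L (M v) = v
}.

Arguments iso_linear {V L M}.
Arguments iso_inv_linear {V L M}.
Arguments iso_cancel {V L M}.
Arguments iso_inv_cancel {V L M}.

Lemma linear_iso_sym {V : NormedModule R_AbsRing} (L M : V -> V) :
  linear_iso L M -> linear_iso M L.
Proof. intros []. split; assumption. Qed.

Definition coordinate_change {n : nat} (U : Rn n -> Prop) (phi : Rn n -> Rn n)
  (V : Rn n -> Prop) (psi : Rn n -> Rn n) : Prop :=
  open_set U /\ open_set V /\
  (forall u, U u -> V (phi u)) /\ (forall v, V v -> U (psi v)) /\
  (forall u, U u -> psi (phi u) = u) /\ (forall v, V v -> phi (psi v) = v) /\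
  smooth_map_on U phi /\ smooth_map_on V psi.

Lemma chart_coordinate_change (n : nat) (x : Rn n) U phi V psi :
  chart_at x U phi V psi -> coordinate_change U phi V psi.
Proof. unfold chart_at, coordinate_change. tauto. Qed.

Lemma coordinate_change_diff2 (n : nat) U phi V psi (x : Rn n) :
  coordinate_change U phi V psi -> U x ->
  exists L M, linear_iso L M /\ diff2 phi x L /\ diff2 psi (phi x) M.
Proof.
  intros [hU [hV [hUV [hVU [psi_phi [phi_psi [smooth_phi smooth_psi]]]]]]] hx.
  destruct (smooth_map_diff2 n n U phi x hU hx smooth_phi) as [L HL].
  destruct (smooth_map_diff2 n n V psi (phi x) hV (hUV x hx) smooth_psi) as [M HM].
  exists L, M. split; [|split; [exact HL|exact HM]].
  split; [apply HL|apply HM|..].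
  - apply (filterdiff_inverse phi psi x); [|apply HL|apply HM].
    generalize (open_set_locally n U x hU hx). apply filter_imp, psi_phi.
  - apply (filterdiff_inverse psi phi (phi x)); [|apply HM|rewrite psi_phi by exact hx; apply HL].
    generalize (open_set_locally n V (phi x) hV (hUV x hx)). apply filter_imp, phi_psi.
Qed.

Section Jets.
Context {V W : NormedModule R_AbsRing}.
Implicit Types (g nf : V -> W) (d Q : V -> W) (L M : V -> V) (D E : W -> W) (lam : W -> R).

(* [d] and [Q] are the linear and quadratic parts of [g] at [x]; composing with
   arbitrary curves rather than lines makes jets stable under changes of coordinates. *)
Definition jet2 g (x : V) d Q : Prop :=
  is_linear d /\
  forall (c : R -> V) (v w : V), c 0 = x -> taylor2 c v w ->
    taylor2 (fun t => g (c t)) (d v) (plus (Q v) (d w)).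

Record jet_equiv d Q d' Q' L M D E : Prop := {
  jet_equiv_source : linear_iso L M;
  jet_equiv_target : linear_iso D E;
  jet_equiv_linear : is_linear d';
  jet_equiv_diff : forall v, d v = D (d' (L v));
  jet_equiv_hess : forall v, d v = zero -> exists c, Q v = D (plus (Q' (L v)) (d' c))
}.

Arguments jet_equiv_source {d Q d' Q' L M D E}.
Arguments jet_equiv_target {d Q d' Q' L M D E}.
Arguments jet_equiv_linear {d Q d' Q' L M D E}.
Arguments jet_equiv_diff {d Q d' Q' L M D E}.
Arguments jet_equiv_hess {d Q d' Q' L M D E}.

Lemma jet_equiv_of_conjugacy g nf (x : V) (phi : V -> V) (psi : W -> W) d Q d' Q' L M D E :
  linear_iso L M -> linear_iso D E ->
  diff2 phi x L -> filterdiff psi (locally (nf (phi x))) D ->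
  locally x (fun y => g y = psi (nf (phi y))) ->
  jet2 g x d Q -> jet2 nf (phi x) d' Q' ->
  jet_equiv d Q d' Q' L M D E.
Proof.
  intros HLM HDE [_ Hphi] Hpsi Hg [linear_d Jg] [linear_d' Jnf].
  assert (Tg : forall v, taylor2 (fun t => g (line x v t)) (d v) (Q v)).
  { intros v. generalize (Jg (line x v) v zero (line_0 x v) (taylor2_line x v)).
    rewrite (linear_zero d linear_d), plus_zero_r. exact (fun h => h). }
  assert (leading_g : forall v k l, (1 <= k)%nat ->
    leading_term k (fun t => nf (phi (line x v t))) l ->
    leading_term k (fun t => g (line x v t)) (D l)).
  { intros v k l hk Hl.
    apply leading_term_ext_loc with (f := fun t => psi (nf (phi (line x v t)))).
    - generalize (locally_line x v _ Hg). apply filter_imp. intros t ht. symmetry. exact ht.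
    - apply (leading_term_comp k psi (fun t => nf (phi (line x v t)))); [exact hk| |exact Hl].
      rewrite line_0. exact Hpsi. }
  assert (Tnf : forall v, exists c, taylor2 (fun t => nf (phi (line x v t)))
    (d' (L v)) (plus (Q' (L v)) (d' c))).
  { intros v. destruct (Hphi v) as [c Hc]. exists c.
    apply (Jnf (fun t => phi (line x v t))); [rewrite line_0; reflexivity|exact Hc]. }
  assert (diff_g : forall v, d v = D (d' (L v))).
  { intros v. destruct (Tnf v) as [c Hc].
    apply (leading_term_unique 1 (fun t => g (line x v t))).
    - exact (taylor2_leading_term_1 _ _ _ (Tg v)).
    - apply leading_g; [lia|exact (taylor2_leading_term_1 _ _ _ Hc)]. }
  split; try assumption. intros v hv. destruct (Tnf v) as [c Hc]. exists c.
  assert (hv' : d' (L v) = zero).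
  { rewrite <- (iso_cancel HDE (d' (L v))), <- diff_g, hv.
    apply (linear_zero E (iso_inv_linear HDE)). }
  rewrite hv' in Hc. specialize (Tg v). rewrite hv in Tg.
  apply (leading_term_unique 2 (fun t => g (line x v t))).
  - exact (taylor2_leading_term_2 _ _ Tg).
  - apply leading_g; [lia|exact (taylor2_leading_term_2 _ _ Hc)].
Qed.

Definition conormal d lam : Prop :=
  is_linear lam /\ (exists y, lam y <> 0) /\ forall v, lam (d v) = 0.

(* The radical of the intrinsic Hessian, the quadratic form [lam o Q] on the kernel of
   [d]: the translations which leave this form invariant. *)
Definition hessian_radical d Q lam (n : V) : Prop :=
  d n = zero /\ forall v, d v = zero -> lam (Q (plus v n)) = lam (Q v).

Definition degenerate_jet d Q : Prop :=
  exists lam n, conormal d lam /\ hessian_radical d Q lam n /\ n <> zero.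

Definition fold_or_cusp_jet d Q : Prop :=
  (exists v, d v <> zero) /\ (exists lam, conormal d lam) /\
  forall lam, conormal d lam ->
    exists n0, forall n, hessian_radical d Q lam n -> exists s : R, n = scal s n0.

Section Transfer.
Context {d Q d' Q' : V -> W} {L M : V -> V} {D E : W -> W} (He : jet_equiv d Q d' Q' L M D E).

Let linear_L : is_linear L := iso_linear (jet_equiv_source He).
Let linear_M : is_linear M := iso_inv_linear (jet_equiv_source He).
Let HML : forall v, M (L v) = v := iso_cancel (jet_equiv_source He).
Let HLM : forall v, L (M v) = v := iso_inv_cancel (jet_equiv_source He).
Let linear_D : is_linear D := iso_linear (jet_equiv_target He).
Let linear_E : is_linear E := iso_inv_linear (jet_equiv_target He).
Let HED : forall y, E (D y) = y := iso_cancel (jet_equiv_target He).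
Let HDE : forall y, D (E y) = y := iso_inv_cancel (jet_equiv_target He).
Let linear_d' : is_linear d' := jet_equiv_linear He.
Let diff_eq : forall v, d v = D (d' (L v)) := jet_equiv_diff He.

Lemma jet_equiv_kernel (v : V) : d v = zero <-> d' (L v) = zero.
Proof.
  rewrite diff_eq. split; intros H.
  - rewrite <- (HED (d' (L v))), H. apply (linear_zero E linear_E).
  - rewrite H. apply (linear_zero D linear_D).
Qed.

Lemma jet_equiv_conormal lam : conormal d lam -> conormal d' (fun y => lam (D y)).
Proof.
  intros [linear_lam [[y hy] H]]. split; [exact (is_linear_comp D lam linear_D linear_lam)|].
  split; [exists (E y); rewrite HDE; exact hy|].
  intros v. rewrite <- (HLM v), <- diff_eq. apply H.
Qed.

Lemma jet_equiv_conormal_inv lam : conormal d' lam -> conormal d (fun y => lam (E y)).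
Proof.
  intros [linear_lam [[y hy] H]]. split; [exact (is_linear_comp E lam linear_E linear_lam)|].
  split; [exists (D y); rewrite HED; exact hy|].
  intros v. rewrite diff_eq, HED. apply H.
Qed.

Lemma jet_equiv_hessian lam (v : V) :
  conormal d lam -> d v = zero -> lam (Q v) = lam (D (Q' (L v))).
Proof.
  intros Hlam hv. destruct (jet_equiv_hess He v hv) as [c ->].
  rewrite (linear_plus D linear_D), (linear_plus lam (proj1 Hlam)).
  rewrite (proj2 (proj2 (jet_equiv_conormal lam Hlam)) c). apply Rplus_0_r.
Qed.

Lemma jet_equiv_radical lam (n : V) : conormal d lam ->
  hessian_radical d Q lam n <-> hessian_radical d' Q' (fun y => lam (D y)) (L n).
Proof.
  intros Hlam. unfold hessian_radical. rewrite jet_equiv_kernel.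
  assert (kernel_plus : forall v, d' (L n) = zero -> d v = zero -> d (plus v n) = zero).
  { intros v hn hv. apply jet_equiv_kernel. apply jet_equiv_kernel in hv.
    rewrite (linear_plus L linear_L), (linear_plus d' linear_d'), hn, hv. apply plus_zero_l. }
  split; intros [hn H]; split; try exact hn.
  - intros v' hv'. rewrite <- (HLM v') in hv' |- *. apply jet_equiv_kernel in hv'.
    rewrite <- (linear_plus L linear_L), <- !jet_equiv_hessian; auto.
  - intros v hv. rewrite !jet_equiv_hessian by auto. rewrite (linear_plus L linear_L).
    apply H, jet_equiv_kernel, hv.
Qed.

Lemma degenerate_jet_equiv : degenerate_jet d Q <-> degenerate_jet d' Q'.
Proof.
  split; intros [lam [n [Hlam [Hn hn]]]].
  - exists (fun y => lam (D y)), (L n). split; [apply jet_equiv_conormal, Hlam|].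
    split; [apply jet_equiv_radical; assumption|].
    intros h. apply hn. rewrite <- (HML n), h.
    apply (linear_zero M linear_M).
  - exists (fun y => lam (E y)), (M n). split; [apply jet_equiv_conormal_inv, Hlam|]. split.
    + apply jet_equiv_radical; [apply jet_equiv_conormal_inv, Hlam|]. rewrite HLM.
      replace (fun y => lam (E (D y))) with lam; [exact Hn|].
      apply functional_extensionality. intros y. rewrite HED. reflexivity.
    + intros h. apply hn. rewrite <- (HLM n), h. apply (linear_zero L linear_L).
Qed.

Lemma fold_or_cusp_jet_equiv : fold_or_cusp_jet d' Q' -> fold_or_cusp_jet d Q.
Proof.
  intros [[v hv] [[lam Hlam] H]]. split; [|split].
  - exists (M v). intros h. apply jet_equiv_kernel in h. rewrite HLM in h. exact (hv h).
  - exists (fun y => lam (E y)). apply jet_equiv_conormal_inv, Hlam.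
  - intros mu Hmu. destruct (H _ (jet_equiv_conormal mu Hmu)) as [n0 Hn0].
    exists (M n0). intros n Hn. apply jet_equiv_radical in Hn; [|exact Hmu].
    destruct (Hn0 _ Hn) as [s Hs]. exists s.
    rewrite <- (HML n), Hs. apply (linear_scal M linear_M).
Qed.

End Transfer.
End Jets.

(** * Normal forms *)

Definition conjugate_at {n m : nat} (g nf : Rn n -> Rn m) (x u : Rn n) : Prop :=
  exists phi psi L M D E,
    linear_iso L M /\ linear_iso D E /\ phi x = u /\
    diff2 phi x L /\ filterdiff psi (locally (nf u)) D /\
    locally x (fun y => g y = psi (nf (phi y))).

Lemma conjugate_at_jet_equiv (n m : nat) (g nf : Rn n -> Rn m) (x u : Rn n) d Q d' Q' :
  conjugate_at g nf x u -> jet2 g x d Q -> jet2 nf u d' Q' ->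
  exists L M D E, jet_equiv d Q d' Q' L M D E.
Proof.
  intros [phi [psi [L [M [D [E [HLM [HDE [<- [Hphi [Hpsi Hg]]]]]]]]]]] Jg Jnf.
  exists L, M, D, E.
  exact (jet_equiv_of_conjugacy g nf x phi psi d Q d' Q' L M D E HLM HDE Hphi Hpsi Hg Jg Jnf).
Qed.

Lemma local_form_conjugate_near (g nf : Rn 4 -> Rn 2) (x : Rn 4) : local_form g x nf ->
  exists phi, phi x = Rn0 4 /\
    locally x (fun y => conjugate_at g nf y (phi y) /\ (phi y = Rn0 4 -> y = x)).
Proof.
  intros [U [phi [V [psi [U' [phi' [V' [psi' [W [HU [HU' [hW [hW0 [hWV [hWU' Hnf]]]]]]]]]]]]]]].
  pose proof (chart_coordinate_change 4 x U phi V psi HU) as HC.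
  pose proof (chart_coordinate_change 2 (g x) U' phi' V' psi' HU') as HC'.
  destruct HU as [hU [_ [hx [phi_x [_ [_ [psi_phi _]]]]]]].
  assert (in_W : forall y, U y -> W (phi y) -> locally y (fun y => U y /\ W (phi y))).
  { intros y hy hWy. apply filter_and; [exact (open_set_locally 4 U y hU hy)|].
    destruct (coordinate_change_diff2 4 U phi V psi y HC hy) as [L [M [_ [[HL _] _]]]].
    apply (filterdiff_continuous phi y (ex_intro _ L HL)).
    exact (open_set_locally 4 W (phi y) hW hWy). }
  exists phi. split; [exact phi_x|].
  assert (hWx : W (phi x)) by (rewrite phi_x; exact hW0).
  generalize (in_W x hx hWx). apply filter_imp. intros y [hy hWy].
  split; [|intros h; rewrite <- (psi_phi y hy), h, <- phi_x; exact (psi_phi x hx)].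
  assert (hgy : U' (g y)) by (rewrite <- (psi_phi y hy); apply hWU', hWy).
  assert (nf_phi : forall z, U z -> W (phi z) -> phi' (g z) = nf (phi z)).
  { intros z hz hWz. rewrite <- (Hnf (phi z) hWz), (psi_phi z hz). reflexivity. }
  destruct (coordinate_change_diff2 4 U phi V psi y HC hy) as [L [M [HLM [HL _]]]].
  destruct (coordinate_change_diff2 2 U' phi' V' psi' (g y) HC' hgy) as [E [D [HED [_ [HD _]]]]].
  exists phi, psi', L, M, D, E.
  split; [exact HLM|]. split; [apply linear_iso_sym, HED|]. split; [reflexivity|].
  split; [exact HL|]. split; [rewrite <- nf_phi; assumption|].
  generalize (in_W y hy hWy). apply filter_imp. intros z [hz hWz].
  rewrite <- nf_phi by assumption. destruct HC' as [_ [_ [_ [_ [psi_phi' _]]]]].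
  symmetry. apply psi_phi'. rewrite <- (psi_phi z hz). apply hWU', hWz.
Qed.

Lemma local_form_conjugate (g nf : Rn 4 -> Rn 2) (x : Rn 4) :
  local_form g x nf -> conjugate_at g nf x (Rn0 4).
Proof.
  intros H. destruct (local_form_conjugate_near g nf x H) as [phi [<- Hphi]].
  exact (proj1 (locally_singleton _ _ Hphi)).
Qed.

Lemma is_linear_mk2 (U : NormedModule R_AbsRing) (l l' : U -> R) :
  is_linear l -> is_linear l' -> is_linear (fun u => mk2 (l u) (l' u)).
Proof. intros H H'. apply is_linear_coordwise. intros [|[|i]] hi; [exact H|exact H'|lia]. Qed.

Lemma taylor2_mk2 (f g : R -> R) (a b a' b' : R) :
  taylor2 f a b -> taylor2 g a' b' ->
  taylor2 (fun t => mk2 (f t) (g t)) (mk2 a a') (mk2 b b').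
Proof. intros H H'. apply taylor2_coordwise. intros [|[|i]] hi; [exact H|exact H'|lia]. Qed.

Lemma linear_form_Rn2 (lam : Rn 2 -> R) (s t : R) : is_linear lam ->
  lam (mk2 s t) = s * lam (mk2 1 0) + t * lam (mk2 0 1).
Proof.
  intros linear_lam.
  change (lam (mk2 s t) = plus (scal s (lam (mk2 1 0))) (scal t (lam (mk2 0 1)))).
  rewrite <- !(linear_scal lam linear_lam), <- (linear_plus lam linear_lam). f_equal.
  apply Rn_ext. intros i hi. rewrite coord_plus, !coord_scal by exact hi.
  destruct i as [|[|i]]; [| |lia]; unfold coord; simpl; ring.
Qed.

Definition mk4 (y1 y2 y3 y4 : R) : Rn 4 :=
  mkRn 4 (fun i => match i with 0%nat => y1 | 1%nat => y2 | 2%nat => y3 | _ => y4 end).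

Lemma mk2_coords (y : Rn 2) : mk2 (coord y 0) (coord y 1) = y.
Proof. apply Rn_ext. intros [|[|i]] hi; [reflexivity|reflexivity|lia]. Qed.

Lemma mk2_eq_zero (s t : R) : mk2 s t = zero <-> s = 0 /\ t = 0.
Proof.
  split.
  - intros H.
    split; [exact (f_equal (fun y => coord y 0) H)|exact (f_equal (fun y => coord y 1) H)].
  - intros [-> ->]. exact (mk2_coords zero).
Qed.

Lemma jet2_nf_regular (u : Rn 4) :
  jet2 nf_regular u nf_regular (fun _ => zero).
Proof.
  split; [apply is_linear_mk2; apply is_linear_coord; lia|].
  intros c v w _ H. rewrite plus_zero_l.
  apply taylor2_mk2; apply (proj2 (taylor2_coordwise 4 c v w) H); lia.
Qed.

Lemma nf_regular_no_conormal (lam : Rn 2 -> R) : ~ conormal nf_regular lam.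
Proof.
  intros [linear_lam [[y hy] H]]. apply hy.
  rewrite <- (H (mk4 (coord y 0) (coord y 1) 0 0)). f_equal. symmetry. exact (mk2_coords y).
Qed.

(* With [k = 0] and [e3 = 1], [-1] these are the folds; the cusps have [e3 = 0], [k = 1]. *)
Section FoldsAndCusps.
Context (e2 e3 k : R) (he2 : e2 <> 0).

Definition fold_cusp_form (u : Rn 4) : Rn 2 :=
  mk2 (x1 u) (x2 u ^ 2 + e2 * x3 u ^ 2 + e3 * x4 u ^ 2 + k * (x1 u * x4 u + x4 u ^ 3)).

Definition fold_cusp_diff (u v : Rn 4) : Rn 2 :=
  mk2 (x1 v) (2 * x2 u * x2 v + 2 * e2 * x3 u * x3 v + k * x4 u * x1 v
              + (2 * e3 * x4 u + k * (x1 u + 3 * x4 u ^ 2)) * x4 v).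

Definition fold_cusp_quad (u v : Rn 4) : R :=
  x2 v ^ 2 + e2 * x3 v ^ 2 + (e3 + 3 * k * x4 u) * x4 v ^ 2 + k * (x1 v * x4 v).

Definition fold_cusp_hess (u v : Rn 4) : Rn 2 := mk2 0 (fold_cusp_quad u v).

Definition fold_cusp_singular (u : Rn 4) : Prop :=
  x2 u = 0 /\ x3 u = 0 /\ 2 * e3 * x4 u + k * (x1 u + 3 * x4 u ^ 2) = 0.

Lemma is_linear_fold_cusp_diff (u : Rn 4) : is_linear (fold_cusp_diff u).
Proof.
  apply is_linear_mk2; [apply is_linear_coord; lia|].
  repeat apply is_linear_Rplus; apply is_linear_coord_scal; lia.
Qed.

Lemma jet2_fold_cusp_form (u : Rn 4) : jet2 fold_cusp_form u (fold_cusp_diff u) (fold_cusp_hess u).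
Proof.
  split; [apply is_linear_fold_cusp_diff|]. intros c v w <- H.
  pose proof (proj2 (taylor2_coordwise 4 c v w) H) as Hc.
  assert (taylor_x1 := Hc 0%nat ltac:(lia)). assert (taylor_x2 := Hc 1%nat ltac:(lia)).
  assert (taylor_x3 := Hc 2%nat ltac:(lia)). assert (taylor_x4 := Hc 3%nat ltac:(lia)).
  assert (taylor_x4_sqr := taylor2_mult _ _ _ _ _ _ taylor_x4 taylor_x4).
  assert (taylor_form := taylor2_plus _ _ _ _ _ _
    (taylor2_plus _ _ _ _ _ _
      (taylor2_plus _ _ _ _ _ _ (taylor2_mult _ _ _ _ _ _ taylor_x2 taylor_x2)
        (taylor2_scal _ _ _ e2 (taylor2_mult _ _ _ _ _ _ taylor_x3 taylor_x3)))
      (taylor2_scal _ _ _ e3 taylor_x4_sqr))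
    (taylor2_scal _ _ _ k
      (taylor2_plus _ _ _ _ _ _ (taylor2_mult _ _ _ _ _ _ taylor_x1 taylor_x4)
        (taylor2_mult _ _ _ _ _ _ taylor_x4 taylor_x4_sqr)))).
  apply taylor2_coordwise. intros [|[|i]] hi; [| |lia].
  - rewrite coord_plus by exact hi. unfold fold_cusp_diff, fold_cusp_hess, coord at 2 3 4; simpl.
    rewrite Rplus_0_l. exact taylor_x1.
  - rewrite coord_plus by exact hi.
    apply taylor2_ext with (4 := taylor_form);
      unfold plus, fold_cusp_form, fold_cusp_diff, fold_cusp_hess, fold_cusp_quad, x1, x2, x3, x4;
      [intros t| |]; unfold coord; simpl; ring.
Qed.

Lemma fold_cusp_conormal_singular (u : Rn 4) (lam : Rn 2 -> R) : conormal (fold_cusp_diff u) lam ->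
  lam (mk2 0 1) <> 0 /\ fold_cusp_singular u.
Proof.
  intros [linear_lam [[y hy] H]].
  assert (annihilates : forall v1 v2 v3 v4, v1 * lam (mk2 1 0) +
    (2 * x2 u * v2 + 2 * e2 * x3 u * v3 + k * x4 u * v1
     + (2 * e3 * x4 u + k * (x1 u + 3 * x4 u ^ 2)) * v4) * lam (mk2 0 1) = 0).
  { intros v1 v2 v3 v4. rewrite <- linear_form_Rn2 by exact linear_lam.
    exact (H (mk4 v1 v2 v3 v4)). }
  assert (lam_neq0 : lam (mk2 0 1) <> 0).
  { intros h. pose proof (annihilates 1 0 0 0) as h'. rewrite h in h'. apply hy.
    rewrite <- (mk2_coords y), linear_form_Rn2, h by exact linear_lam.
    replace (lam (mk2 1 0)) with 0 by lra. ring. }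
  split; [exact lam_neq0|]. pose proof (annihilates 0 1 0 0). pose proof (annihilates 0 0 1 0).
  pose proof (annihilates 0 0 0 1). split; [|split].
  - apply (Rmult_eq_reg_r (2 * lam (mk2 0 1))); lra.
  - apply (Rmult_eq_reg_r (2 * e2 * lam (mk2 0 1))); [lra|].
    apply Rmult_integral_contrapositive_currified; lra.
  - apply (Rmult_eq_reg_r (lam (mk2 0 1))); [lra|exact lam_neq0].
Qed.

Lemma fold_cusp_diff_singular (u v : Rn 4) :
  fold_cusp_singular u -> fold_cusp_diff u v = mk2 (x1 v) (k * x4 u * x1 v).
Proof.
  intros [u2 [u3 u4]]. unfold fold_cusp_diff. rewrite u2, u3, u4. f_equal. ring.
Qed.

Lemma fold_cusp_kernel (u v : Rn 4) :
  fold_cusp_singular u -> fold_cusp_diff u v = zero <-> x1 v = 0.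
Proof.
  intros Hu. rewrite fold_cusp_diff_singular, mk2_eq_zero by exact Hu.
  split; [tauto|]. intros h. rewrite h. split; ring.
Qed.

Lemma fold_cusp_conormal_exists (u : Rn 4) :
  fold_cusp_singular u -> exists lam, conormal (fold_cusp_diff u) lam.
Proof.
  intros Hu. exists (fun y => coord y 1 + (- (k * x4 u)) * coord y 0). split; [|split].
  - apply is_linear_Rplus; [apply is_linear_coord|apply is_linear_coord_scal]; lia.
  - exists (mk2 0 1). change (1 + - (k * x4 u) * 0 <> 0). lra.
  - intros v. rewrite fold_cusp_diff_singular by exact Hu.
    change (k * x4 u * x1 v + - (k * x4 u) * x1 v = 0). ring.
Qed.

Lemma fold_cusp_radical_iff (u : Rn 4) (lam : Rn 2 -> R) (n : Rn 4) :
  conormal (fold_cusp_diff u) lam ->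
  hessian_radical (fold_cusp_diff u) (fold_cusp_hess u) lam n <->
  x1 n = 0 /\ x2 n = 0 /\ x3 n = 0 /\ (e3 + 3 * k * x4 u) * x4 n = 0.
Proof.
  intros Hlam. destruct (fold_cusp_conormal_singular u lam Hlam) as [hlam Hu].
  assert (quad : forall v, lam (fold_cusp_hess u v) = fold_cusp_quad u v * lam (mk2 0 1)).
  { intros v. unfold fold_cusp_hess. rewrite linear_form_Rn2 by apply Hlam. ring. }
  assert (translate : forall v, x1 v = 0 -> x1 n = 0 ->
    fold_cusp_quad u (plus v n) = fold_cusp_quad u v +
      (x2 n * (2 * x2 v + x2 n) + e2 * x3 n * (2 * x3 v + x3 n)
       + (e3 + 3 * k * x4 u) * x4 n * (2 * x4 v + x4 n))).
  { intros v hv hn. unfold fold_cusp_quad, x1, x2, x3, x4 in *.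
    rewrite !coord_plus, hv, hn by lia. ring. }
  unfold hessian_radical. rewrite fold_cusp_kernel by exact Hu. split.
  - intros [n_kernel H]. split; [exact n_kernel|].
    assert (invariant : forall y2 y3 y4, x2 n * (2 * y2 + x2 n) + e2 * x3 n * (2 * y3 + x3 n)
      + (e3 + 3 * k * x4 u) * x4 n * (2 * y4 + x4 n) = 0).
    { intros y2 y3 y4.
      assert (E := H (mk4 0 y2 y3 y4) (proj2 (fold_cusp_kernel u (mk4 0 y2 y3 y4) Hu) eq_refl)).
      rewrite !quad in E. apply Rmult_eq_reg_r in E; [|exact hlam].
      rewrite translate in E by (assumption || reflexivity).
      change (x2 (mk4 0 y2 y3 y4)) with y2 in E. change (x3 (mk4 0 y2 y3 y4)) with y3 in E.
      change (x4 (mk4 0 y2 y3 y4)) with y4 in E. lra. }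
    pose proof (invariant 0 0 0). pose proof (invariant 1 0 0).
    pose proof (invariant 0 1 0). pose proof (invariant 0 0 1).
    split; [lra|]. split; [|lra]. apply (Rmult_eq_reg_l (2 * e2)); lra.
  - intros [n1 [n2 [n3 n4]]]. split; [exact n1|]. intros v hv.
    apply (fold_cusp_kernel u v Hu) in hv. rewrite !quad, translate, n2, n3, n4 by assumption. ring.
Qed.

Lemma fold_cusp_singular_jet (u : Rn 4) :
  fold_cusp_singular u -> fold_or_cusp_jet (fold_cusp_diff u) (fold_cusp_hess u).
Proof.
  intros Hu. split; [|split].
  - exists (mk4 1 0 0 0). rewrite fold_cusp_kernel by exact Hu. exact R1_neq_R0.
  - apply fold_cusp_conormal_exists, Hu.
  - intros lam Hlam. exists (mk4 0 0 0 1). intros n Hn.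
    apply fold_cusp_radical_iff in Hn; [|exact Hlam]. destruct Hn as [n1 [n2 [n3 _]]].
    exists (x4 n). apply Rn_ext. intros i hi. rewrite coord_scal by exact hi.
    destruct i as [|[|[|[|i]]]]; [| | | |lia].
    + change (x1 n = x4 n * 0). lra.
    + change (x2 n = x4 n * 0). lra.
    + change (x3 n = x4 n * 0). lra.
    + change (x4 n = x4 n * 1). lra.
Qed.

Lemma fold_cusp_degenerate_iff (u : Rn 4) :
  degenerate_jet (fold_cusp_diff u) (fold_cusp_hess u) <->
  fold_cusp_singular u /\ e3 + 3 * k * x4 u = 0.
Proof.
  split.
  - intros [lam [n [Hlam [Hn hn]]]]. split; [apply (fold_cusp_conormal_singular u lam Hlam)|].
    apply fold_cusp_radical_iff in Hn; [|exact Hlam]. destruct Hn as [n1 [n2 [n3 n4]]].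
    apply Rmult_integral in n4. destruct n4 as [n4|n4]; [exact n4|].
    exfalso. apply hn, Rn_ext. intros [|[|[|[|i]]]] hi; [exact n1|exact n2|exact n3|exact n4|lia].
  - intros [Hu h]. destruct (fold_cusp_conormal_exists u Hu) as [lam Hlam].
    exists lam, (mk4 0 0 0 1). split; [exact Hlam|]. split.
    + apply fold_cusp_radical_iff; [exact Hlam|]. rewrite h. repeat split. ring.
    + intros E. apply (f_equal x4) in E. exact (R1_neq_R0 E).
Qed.

End FoldsAndCusps.

Lemma nf_def_fold_eq : nf_def_fold = fold_cusp_form 1 1 0.
Proof.
  apply functional_extensionality. intros u. unfold nf_def_fold, fold_cusp_form. f_equal. ring.
Qed.

Lemma nf_indef_fold_eq : nf_indef_fold = fold_cusp_form 1 (-1) 0.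
Proof.
  apply functional_extensionality. intros u. unfold nf_indef_fold, fold_cusp_form. f_equal. ring.
Qed.

Lemma nf_cusp_eq (s : bool) : nf_cusp s = fold_cusp_form (if s then 1 else -1) 0 1.
Proof.
  apply functional_extensionality. intros u. unfold nf_cusp, fold_cusp_form. f_equal.
  destruct s; ring.
Qed.

Lemma fold_cusp_singular_0 (e3 k : R) : fold_cusp_singular e3 k (Rn0 4).
Proof. unfold fold_cusp_singular, x1, x2, x3, x4, coord; simpl. repeat split; ring. Qed.

Section SingularPoints.
Context (g : Rn 4 -> Rn 2) (d Q : Rn 4 -> Rn 4 -> Rn 2) (Jg : forall x, jet2 g x (d x) (Q x)).

Lemma regular_no_conormal (x : Rn 4) (lam : Rn 2 -> R) :
  local_form g x nf_regular -> ~ conormal (d x) lam.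
Proof.
  intros H Hlam.
  destruct (conjugate_at_jet_equiv 4 2 g nf_regular x _ _ _ _ _ (local_form_conjugate _ _ _ H)
    (Jg x) (jet2_nf_regular _)) as [L [M [D [E He]]]].
  exact (nf_regular_no_conormal _ (jet_equiv_conormal He lam Hlam)).
Qed.

Lemma fold_cusp_form_jets (e2 e3 k : R) (x : Rn 4) : e2 <> 0 ->
  local_form g x (fold_cusp_form e2 e3 k) ->
  fold_or_cusp_jet (d x) (Q x) /\ (degenerate_jet (d x) (Q x) <-> e3 = 0).
Proof.
  intros he2 H.
  destruct (conjugate_at_jet_equiv 4 2 g _ x _ _ _ _ _ (local_form_conjugate _ _ _ H)
    (Jg x) (jet2_fold_cusp_form e2 e3 k _)) as [L [M [D [E He]]]].
  split.
  - apply (fold_or_cusp_jet_equiv He), fold_cusp_singular_jet; [exact he2|].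
    apply fold_cusp_singular_0.
  - rewrite (degenerate_jet_equiv He), fold_cusp_degenerate_iff by exact he2.
    replace (x4 (Rn0 4)) with 0 by reflexivity. rewrite Rmult_0_r, Rplus_0_r.
    split; [tauto|]. intros h. split; [apply fold_cusp_singular_0|exact h].
Qed.

Lemma cusp_jet (x : Rn 4) :
  is_cusp g x -> fold_or_cusp_jet (d x) (Q x) /\ degenerate_jet (d x) (Q x).
Proof.
  intros [s H]. rewrite nf_cusp_eq in H.
  assert (hs : (if s then 1 else -1) <> 0) by (destruct s; lra).
  destruct (fold_cusp_form_jets _ _ _ x hs H) as [Hline Hdeg].
  split; [exact Hline|apply Hdeg; reflexivity].
Qed.

Lemma cusp_isolated (x : Rn 4) : is_cusp g x -> locally x (fun y => is_cusp g y -> y = x).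
Proof.
  intros [s H]. rewrite nf_cusp_eq in H.
  destruct (local_form_conjugate_near g _ x H) as [phi [_ Hphi]].
  revert Hphi. apply filter_imp. intros y [Hy hy] Hcusp. apply hy.
  destruct (conjugate_at_jet_equiv 4 2 g _ y _ _ _ _ _ Hy (Jg y)
    (jet2_fold_cusp_form _ 0 1 (phi y))) as [L [M [D [E He]]]].
  pose proof (proj1 (degenerate_jet_equiv He) (proj2 (cusp_jet y Hcusp))) as Hdeg.
  apply fold_cusp_degenerate_iff in Hdeg; [|destruct s; lra].
  destruct Hdeg as [[phi2 [phi3 phi1]] phi4].
  apply Rn_ext. intros [|[|[|[|i]]]] hi; [|exact phi2|exact phi3| |lia];
    change (coord (Rn0 4) _) with 0.
  - change (coord (phi y) 0) with (x1 (phi y)). nra.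
  - change (coord (phi y) 3) with (x4 (phi y)). lra.
Qed.

End SingularPoints.

(** * The jets of F *)

Definition taylor2C (h : R -> C) (a b : C) : Prop :=
  taylor2 (fun t => fst (h t)) (fst a) (fst b) /\ taylor2 (fun t => snd (h t)) (snd a) (snd b).

Lemma taylor2C_ext (f g : R -> C) (a b a' b' : C) :
  (forall t, f t = g t) -> a = a' -> b = b' -> taylor2C f a b -> taylor2C g a' b'.
Proof.
  intros E <- <- [Re_f Im_f].
  split; [apply taylor2_ext with (4 := Re_f)|apply taylor2_ext with (4 := Im_f)];
    try reflexivity; intros t; rewrite E; reflexivity.
Qed.

Lemma taylor2C_const (c : C) : taylor2C (fun _ => c) 0 0.
Proof. split; apply (taylor2_const (V := R_NormedModule)). Qed.

Lemma taylor2C_plus (f g : R -> C) (a b a' b' : C) :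
  taylor2C f a b -> taylor2C g a' b' ->
  taylor2C (fun t => f t + g t)%C (a + a')%C (b + b')%C.
Proof.
  intros [Re_f Im_f] [Re_g Im_g].
  split; apply (taylor2_plus (V := R_NormedModule)); assumption.
Qed.

Lemma taylor2C_mult (f g : R -> C) (a b a' b' : C) :
  taylor2C f a b -> taylor2C g a' b' ->
  taylor2C (fun t => f t * g t)%C (a * g 0 + f 0 * a')%C (b * g 0 + a * a' + f 0 * b')%C.
Proof.
  intros [Re_f Im_f] [Re_g Im_g]. split.
  - apply taylor2_ext with (4 := taylor2_plus _ _ _ _ _ _ (taylor2_mult _ _ _ _ _ _ Re_f Re_g)
      (taylor2_scal _ _ _ (-1) (taylor2_mult _ _ _ _ _ _ Im_f Im_g)));
      [intros t|..]; unfold plus; simpl; ring.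
  - apply taylor2_ext with (4 := taylor2_plus _ _ _ _ _ _ (taylor2_mult _ _ _ _ _ _ Re_f Im_g)
      (taylor2_mult _ _ _ _ _ _ Im_f Re_g)); [intros t|..]; unfold plus; simpl; ring.
Qed.

Lemma taylor2C_conj (f : R -> C) (a b : C) :
  taylor2C f a b -> taylor2C (fun t => Cconj (f t)) (Cconj a) (Cconj b).
Proof.
  intros [Re_f Im_f]. split; [exact Re_f|].
  apply taylor2_ext with (4 := taylor2_scal _ _ _ (-1) Im_f); [intros t|..]; simpl; ring.
Qed.

Definition pow_deriv (p : nat) (z : C) : C := (INR p * z ^ (p - 1))%C.
Definition pow_deriv2 (p : nat) (z : C) : C := (INR p * INR (p - 1) * z ^ (p - 2))%C.

Lemma taylor2C_pow (p : nat) (f : R -> C) (a b : C) :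
  taylor2C f a b ->
  taylor2C (fun t => f t ^ p)%C (pow_deriv p (f 0) * a)%C
    (/ 2 * (pow_deriv2 p (f 0) * a ^ 2) + pow_deriv p (f 0) * b)%C.
Proof.
  intros H. induction p as [|p IH].
  - apply taylor2C_ext with (4 := taylor2C_const 1); [reflexivity|..];
      unfold pow_deriv, pow_deriv2; simpl; ring.
  - apply taylor2C_ext with (4 := taylor2C_mult _ _ _ _ _ _ H IH); [reflexivity|..];
      unfold pow_deriv, pow_deriv2; destruct p as [|[|p]];
      rewrite ?Nat.sub_succ, ?Nat.sub_0_r, ?S_INR, ?RtoC_plus; simpl; field.
Qed.

Definition z_coord (x : Rn 4) : C := (coord x 0, coord x 1).
Definition w_coord (x : Rn 4) : C := (coord x 2, coord x 3).

Definition zw_point (z w : C) : Rn 4 := mk4 (fst z) (snd z) (fst w) (snd w).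

Lemma z_coord_point (z w : C) : z_coord (zw_point z w) = z.
Proof. destruct z. reflexivity. Qed.

Lemma w_coord_point (z w : C) : w_coord (zw_point z w) = w.
Proof. destruct w. reflexivity. Qed.

Lemma zw_point_inj (z w z' w' : C) : zw_point z w = zw_point z' w' -> z = z' /\ w = w'.
Proof.
  intros E. split.
  - rewrite <- (z_coord_point z w), E. apply z_coord_point.
  - rewrite <- (w_coord_point z w), E. apply w_coord_point.
Qed.

Lemma zw_point_coords (x : Rn 4) : zw_point (z_coord x) (w_coord x) = x.
Proof. apply Rn_ext. intros [|[|[|[|i]]]] hi; try reflexivity; lia. Qed.

Lemma zw_point_0 : zw_point 0 0 = zero.
Proof. apply Rn_ext. intros [|[|[|[|i]]]] hi; reflexivity. Qed.

Lemma z_coord_plus (x y : Rn 4) : z_coord (plus x y) = (z_coord x + z_coord y)%C.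
Proof. unfold z_coord. rewrite !coord_plus by lia. reflexivity. Qed.

Lemma w_coord_plus (x y : Rn 4) : w_coord (plus x y) = (w_coord x + w_coord y)%C.
Proof. unfold w_coord. rewrite !coord_plus by lia. reflexivity. Qed.

Definition Rn2_of_C (c : C) : Rn 2 := mk2 (fst c) (snd c).

Lemma Defs_Cpow_eq (z : C) (n : nat) : Defs.Cpow z n = (z ^ n)%C.
Proof. induction n as [|n IH]; [reflexivity|]. simpl. rewrite IH. reflexivity. Qed.

Lemma Fmap_eq (p q : nat) (a b : C) (x : Rn 4) :
  Fmap p q a b x = Rn2_of_C (z_coord x ^ p + w_coord x ^ q
    + (a * Cconj (z_coord x) + b * Cconj (w_coord x))).
Proof. unfold Fmap. cbv zeta. rewrite !Defs_Cpow_eq. reflexivity. Qed.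

Definition Fmap_diff (p q : nat) (a b : C) (x v : Rn 4) : C :=
  (pow_deriv p (z_coord x) * z_coord v + pow_deriv q (w_coord x) * w_coord v
   + (a * Cconj (z_coord v) + b * Cconj (w_coord v)))%C.

Definition Fmap_hess (p q : nat) (x v : Rn 4) : C :=
  (/ 2 * (pow_deriv2 p (z_coord x) * z_coord v ^ 2
          + pow_deriv2 q (w_coord x) * w_coord v ^ 2))%C.

Lemma is_linear_Fmap_diff (p q : nat) (a b : C) (x : Rn 4) :
  is_linear (fun v => Rn2_of_C (Fmap_diff p q a b x v)).
Proof.
  assert (lin : forall r0 r1 r2 r3, is_linear (fun v : Rn 4 =>
    r0 * coord v 0 + r1 * coord v 1 + r2 * coord v 2 + r3 * coord v 3)).
  { intros. repeat apply is_linear_Rplus; apply is_linear_coord_scal; lia. }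
  unfold Fmap_diff. generalize (pow_deriv p (z_coord x)) (pow_deriv q (w_coord x)). intros A B.
  apply is_linear_mk2.
  - apply is_linear_ext with (2 := lin (fst A + fst a) (- snd A + snd a) (fst B + fst b)
      (- snd B + snd b)). intros v. simpl. ring.
  - apply is_linear_ext with (2 := lin (snd A + snd a) (fst A - fst a) (snd B + snd b)
      (fst B - fst b)). intros v. simpl. ring.
Qed.

Lemma Fmap_jet2 (p q : nat) (a b : C) (x : Rn 4) :
  jet2 (Fmap p q a b) x (fun v => Rn2_of_C (Fmap_diff p q a b x v))
    (fun v => Rn2_of_C (Fmap_hess p q x v)).
Proof.
  split; [apply is_linear_Fmap_diff|]. intros c v w <- H.
  pose proof (proj2 (taylor2_coordwise 4 c v w) H) as Hc.
  assert (Hz : taylor2C (fun t => z_coord (c t)) (z_coord v) (z_coord w)) by (split; apply Hc; lia).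
  assert (Hw : taylor2C (fun t => w_coord (c t)) (w_coord v) (w_coord w)) by (split; apply Hc; lia).
  pose proof (taylor2C_plus _ _ _ _ _ _
    (taylor2C_plus _ _ _ _ _ _ (taylor2C_pow p _ _ _ Hz) (taylor2C_pow q _ _ _ Hw))
    (taylor2C_plus _ _ _ _ _ _
      (taylor2C_mult _ _ _ _ _ _ (taylor2C_const a) (taylor2C_conj _ _ _ Hz))
      (taylor2C_mult _ _ _ _ _ _ (taylor2C_const b) (taylor2C_conj _ _ _ Hw)))) as [Re_F Im_F].
  apply taylor2_ext with (f := fun t => Rn2_of_C
      (z_coord (c t) ^ p + w_coord (c t) ^ q
       + (a * Cconj (z_coord (c t)) + b * Cconj (w_coord (c t)))))
    (4 := taylor2_mk2 _ _ _ _ _ _ Re_F Im_F).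
  - intros t. rewrite Fmap_eq. reflexivity.
  - unfold Rn2_of_C, Fmap_diff. f_equal; f_equal; ring.
  - apply Rn_ext. intros i hi. rewrite coord_plus by exact hi.
    unfold Fmap_hess, Fmap_diff, Rn2_of_C.
    destruct i as [|[|i]]; [| |lia]; unfold coord; simpl; ring.
Qed.

Lemma Cmult_integral (x y : C) : (x * y)%C = 0 -> x = 0 \/ y = 0.
Proof.
  intros H. apply (f_equal Cmod) in H. rewrite Cmod_mult, Cmod_0 in H.
  apply Rmult_integral in H. destruct H as [H|H]; apply Cmod_eq_0 in H; auto.
Qed.

Lemma Cconj_0 : Cconj 0 = 0.
Proof. unfold Cconj, RtoC; simpl; f_equal; ring. Qed.

Lemma Cconj_neq0 (c : C) : c <> 0 -> Cconj c <> 0.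
Proof. intros hc h. apply hc. rewrite <- (Cconj_conj c), h. apply Cconj_0. Qed.

Lemma Copp_neq0 (c : C) : c <> 0 -> (- c)%C <> 0.
Proof. intros hc h. apply hc. replace c with (- - c)%C by ring. rewrite h. ring. Qed.

Lemma Re_mult_all_eq0 (c : C) : (forall x : C, Re (c * x) = 0) -> c = 0.
Proof.
  intros H. specialize (H (Cconj c)). rewrite <- Cmod2_conj in H.
  apply Cmod_eq_0. simpl in H. nra.
Qed.

(* The quadratic form [Re (P x^2 + Q y^2) / 2] on the kernel of the real linear form
   [Im (A x + B y)]. *)
Section ComplexQuadraticForm.
Context (A B P Q : C).

Definition im_form (x y : C) : R := Im (A * x + B * y).

Definition polar_form (m n x y : C) : R := Re (P * (m * x) + Q * (n * y)).

Definition complex_radical (m n : C) : Prop :=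
  im_form m n = 0 /\ forall x y, im_form x y = 0 -> polar_form m n x y = 0.

Lemma im_form_plus (x y x' y' : C) : im_form (x + x') (y + y') = im_form x y + im_form x' y'.
Proof. unfold im_form. rewrite <- im_plus. f_equal. ring. Qed.

Lemma im_form_scal (s : R) (x y : C) : im_form (s * x) (s * y) = s * im_form x y.
Proof. unfold im_form. rewrite <- im_scal_l. f_equal. ring. Qed.

Lemma polar_form_plus (m n x y x' y' : C) :
  polar_form m n (x + x') (y + y') = polar_form m n x y + polar_form m n x' y'.
Proof. unfold polar_form. rewrite <- re_plus. f_equal. ring. Qed.

Lemma polar_form_scal (s : R) (m n x y : C) :
  polar_form m n (s * x) (s * y) = s * polar_form m n x y.
Proof. unfold polar_form. rewrite <- re_scal_l. f_equal. ring. Qed.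

Lemma polar_form_sym (m n x y : C) : polar_form m n x y = polar_form x y m n.
Proof. unfold polar_form. f_equal. ring. Qed.

Lemma polar_form_nondegenerate (m n : C) : P <> 0 -> Q <> 0 ->
  (forall x y, polar_form m n x y = 0) -> m = 0 /\ n = 0.
Proof.
  intros hP hQ H.
  assert (hm : (P * m)%C = 0).
  { apply Re_mult_all_eq0. intros x. rewrite <- (H x 0). unfold polar_form. f_equal. ring. }
  assert (hn : (Q * n)%C = 0).
  { apply Re_mult_all_eq0. intros y. rewrite <- (H 0 y). unfold polar_form. f_equal. ring. }
  apply Cmult_integral in hm, hn. tauto.
Qed.

Definition normal_x : C := (- Ci * A / P)%C.
Definition normal_y : C := (- Ci * B / Q)%C.

Definition discriminant : C := (A ^ 2 / P + B ^ 2 / Q)%C.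

Lemma polar_form_normal (x y : C) : P <> 0 -> Q <> 0 ->
  polar_form normal_x normal_y x y = im_form x y.
Proof.
  intros hP hQ. unfold polar_form, im_form, normal_x, normal_y.
  replace (P * (- Ci * A / P * x) + Q * (- Ci * B / Q * y))%C
    with (- Ci * (A * x + B * y))%C by (field; auto).
  generalize (A * x + B * y)%C. intros [u v]; simpl; ring.
Qed.

Lemma im_form_normal : P <> 0 -> Q <> 0 -> im_form normal_x normal_y = - Re discriminant.
Proof.
  intros hP hQ. unfold im_form, normal_x, normal_y.
  replace (A * (- Ci * A / P) + B * (- Ci * B / Q))%C
    with (- Ci * discriminant)%C by (unfold discriminant; field; auto).
  generalize discriminant. intros [u v]; simpl; ring.
Qed.

Lemma im_form_onto : A <> 0 \/ B <> 0 -> exists x y, im_form x y = 1.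
Proof.
  unfold im_form. intros [hA|hB].
  - exists (Ci / A)%C, (RtoC 0). replace (A * (Ci / A) + B * 0)%C with Ci by (field; exact hA).
    reflexivity.
  - exists (RtoC 0), (Ci / B)%C. replace (A * 0 + B * (Ci / B))%C with Ci by (field; exact hB).
    reflexivity.
Qed.

(* A form vanishing on the kernel of [im_form] is a multiple of it. *)
Lemma complex_radical_multiple_of_normal (m n : C) :
  P <> 0 -> Q <> 0 -> A <> 0 \/ B <> 0 -> complex_radical m n ->
  exists s : R, m = (s * normal_x)%C /\ n = (s * normal_y)%C.
Proof.
  intros hP hQ hAB [_ H]. destruct (im_form_onto hAB) as [x0 [y0 im_form_1]].
  set (s := polar_form m n x0 y0). exists s.
  assert (polar_eq : forall x y, polar_form m n x y = s * im_form x y).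
  { intros x y. set (r := - im_form x y).
    assert (on_kernel : im_form (x + r * x0) (y + r * y0) = 0).
    { rewrite im_form_plus, im_form_scal, im_form_1. unfold r. ring. }
    apply H in on_kernel. rewrite polar_form_plus, polar_form_scal in on_kernel.
    unfold r in on_kernel.
    unfold s. lra. }
  destruct (polar_form_nondegenerate (m + (- s)%R * normal_x) (n + (- s)%R * normal_y) hP hQ)
    as [diff_m diff_n].
  { intros x y. rewrite polar_form_sym, polar_form_plus, polar_form_scal.
    rewrite !(polar_form_sym x y), polar_eq, polar_form_normal by assumption. ring. }
  rewrite RtoC_opp in diff_m, diff_n. split; apply Ceq_minus.
  - rewrite <- diff_m. ring.
  - rewrite <- diff_n. ring.
Qed.

Lemma complex_radical_nontrivial_iff : P <> 0 -> Q <> 0 -> A <> 0 \/ B <> 0 ->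
  (exists m n, complex_radical m n /\ (m <> 0 \/ n <> 0)) <-> Re discriminant = 0.
Proof.
  intros hP hQ hAB. split.
  - intros [m [n [Hmn hmn]]].
    destruct (complex_radical_multiple_of_normal m n hP hQ hAB Hmn) as [s [-> ->]].
    destruct Hmn as [H _]. rewrite im_form_scal, im_form_normal in H by assumption.
    apply Rmult_integral in H. destruct H as [->|H]; [exfalso|lra].
    destruct hmn as [h|h]; apply h; ring.
  - intros H. exists normal_x, normal_y. split; [split|].
    + rewrite im_form_normal, H by assumption. ring.
    + intros x y h. rewrite polar_form_normal by assumption. exact h.
    + destruct (im_form_onto hAB) as [x [y h]]. rewrite <- polar_form_normal in h by assumption.
      destruct (Ceq_dec normal_x 0) as [hx|hx]; [right|auto].
      destruct (Ceq_dec normal_y 0) as [hy|hy]; [exfalso|exact hy].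
      rewrite hx, hy in h. unfold polar_form in h. rewrite !Cmult_0_l, !Cmult_0_r, Cplus_0_r in h.
      simpl in h. lra.
Qed.

End ComplexQuadraticForm.

Lemma complex_radical_swap (A B P Q m n : C) :
  complex_radical A B P Q m n <-> complex_radical B A Q P n m.
Proof.
  assert (im_swap : forall A B x y, im_form A B x y = im_form B A y x)
    by (intros; unfold im_form; f_equal; ring).
  assert (polar_swap : forall P Q m n x y, polar_form P Q m n x y = polar_form Q P n m y x)
    by (intros; unfold polar_form; f_equal; ring).
  unfold complex_radical. rewrite im_swap. split; intros [h H]; split; try exact h;
    intros x y hxy; rewrite polar_swap; apply H; rewrite im_swap; exact hxy.
Qed.

Lemma complex_radical_of_zero_coeffs (B Q m : C) : complex_radical 0 B 0 Q m 0.
Proof.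
  split.
  - unfold im_form. replace (0 * m + B * 0)%C with (RtoC 0) by ring. reflexivity.
  - intros x y _. unfold polar_form.
    replace (0 * (m * x) + Q * (0 * y))%C with (RtoC 0) by ring. reflexivity.
Qed.

(** * The cusp equations *)

Definition singular_at (p q : nat) (a b z w u : C) : Prop :=
  Cmod u = 1 /\ pow_deriv p z = (- (u * Cconj a))%C /\ pow_deriv q w = (- (u * Cconj b))%C.

Definition cusp_form (p q : nat) (z w : C) : C :=
  (INR p * INR (q - 1) * z ^ p + INR q * INR (p - 1) * w ^ q)%C.

Definition cusp_eqs (p q : nat) (a b z w : C) : Prop :=
  exists u, singular_at p q a b z w u /\
    (cusp_form p q z w + u * Cconj (cusp_form p q z w))%C = 0.

Lemma INR_C_neq0 (n : nat) : (0 < n)%nat -> RtoC (INR n) <> 0.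
Proof. intros h H. apply RtoC_inj in H. apply INR_eq with (m := 0%nat) in H. lia. Qed.

Lemma pow_deriv_0 (n : nat) : (2 <= n)%nat -> pow_deriv n 0 = 0.
Proof.
  intros hn. unfold pow_deriv. replace (n - 1)%nat with (S (n - 2)) by lia. rewrite Cpow_S. ring.
Qed.

Lemma pow_deriv_eq0_of_deriv2 (n : nat) (c : C) :
  (2 <= n)%nat -> pow_deriv2 n c = 0 -> pow_deriv n c = 0.
Proof.
  intros hn H. destruct (Ceq_dec c 0) as [->|hc]; [apply pow_deriv_0, hn|exfalso].
  revert H. unfold pow_deriv2. repeat apply Cmult_neq_0; try (apply INR_C_neq0; lia).
  apply Cpow_nz, hc.
Qed.

Lemma pow_deriv_sqr (p : nat) (z : C) : (2 <= p)%nat ->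
  (INR (p - 1) * pow_deriv p z ^ 2)%C = (INR p * z ^ p * pow_deriv2 p z)%C.
Proof.
  intros hp. unfold pow_deriv, pow_deriv2.
  replace (z ^ p)%C with (z * z ^ (p - 1))%C by (rewrite <- Cpow_S; f_equal; lia).
  replace (z ^ (p - 1))%C with (z * z ^ (p - 2))%C by (rewrite <- Cpow_S; f_equal; lia).
  ring.
Qed.

Lemma Cmod1_conj (u : C) : Cmod u = 1 -> (u * Cconj u)%C = 1.
Proof. intros H. rewrite <- Cmod2_conj, H. f_equal. ring. Qed.

Lemma conj_eq_unit_mult (u : C) : Cmod u = 1 -> exists al : C, al <> 0 /\ Cconj al = (u * al)%C.
Proof.
  intros H. pose proof (Cmod1_conj u H) as E.
  destruct (Ceq_dec (1 + Cconj u)%C 0) as [h|h].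
  - exists Ci. split; [exact Ci_nz|].
    replace u with (Cconj (Cconj u)) by apply Cconj_conj.
    replace (Cconj u) with (- (1))%C by (rewrite <- (Cplus_0_r (- (1))), <- h; ring).
    apply injective_projections; simpl; ring.
  - exists (1 + Cconj u)%C. split; [exact h|].
    rewrite Cplus_conj, Cconj_conj, Cmult_plus_distr_l, E.
    apply injective_projections; simpl; ring.
Qed.

Lemma unit_conj_quotient (al : C) : al <> 0 -> exists u : C, Cmod u = 1 /\ Cconj al = (u * al)%C.
Proof.
  intros h. exists (Cconj al / al)%C. split; [|field; exact h].
  rewrite Cmod_div by exact h. rewrite Cmod_conj. field.
  apply Rgt_not_eq, Cmod_gt_0, h.
Qed.

Lemma Re_mult_eq0_iff (al u g : C) : al <> 0 -> Cconj al = (u * al)%C ->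
  Re (al * g) = 0 <-> (g + u * Cconj g)%C = 0.
Proof.
  intros h E.
  assert (twice_Re : RtoC (2 * Re (al * g)) = (al * (g + u * Cconj g))%C).
  { rewrite RtoC_mult, re_alt, Cmult_conj, E. field. }
  split; intros H; rewrite H in twice_Re.
  - rewrite Rmult_0_r in twice_Re. symmetry in twice_Re. apply Cmult_integral in twice_Re. tauto.
  - rewrite Cmult_0_r in twice_Re. apply RtoC_inj in twice_Re. lra.
Qed.

Lemma linear_form_Rn2_of_C (lam : Rn 2 -> R) : is_linear lam ->
  exists al : C, forall c, lam (Rn2_of_C c) = Re (al * c).
Proof.
  intros H. exists (lam (mk2 1 0), - lam (mk2 0 1)). intros c.
  unfold Rn2_of_C. rewrite linear_form_Rn2 by exact H. simpl. ring.
Qed.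

Lemma Rn2_of_C_eq_zero (c : C) : Rn2_of_C c = zero <-> c = 0.
Proof.
  unfold Rn2_of_C. rewrite mk2_eq_zero. split.
  - intros [hre him]. apply injective_projections; assumption.
  - intros ->. split; reflexivity.
Qed.

Lemma collinear_minor (n i j : nat) (x y v : Rn n) (s t : R) : (i < n)%nat -> (j < n)%nat ->
  x = scal s v -> y = scal t v -> coord x i * coord y j = coord x j * coord y i.
Proof. intros hi hj -> ->. rewrite !coord_scal by assumption. ring. Qed.

Section ConormalsOfFmap.
Context (p q : nat) (a b : C) (x : Rn 4).

Let z := z_coord x.
Let w := w_coord x.
Let dF (v : Rn 4) : Rn 2 := Rn2_of_C (Fmap_diff p q a b x v).
Let QF (v : Rn 4) : Rn 2 := Rn2_of_C (Fmap_hess p q x v).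

Definition conormal_eqs (al : C) : Prop :=
  (al * pow_deriv p z = - Cconj (al * a) /\ al * pow_deriv q w = - Cconj (al * b))%C.

Lemma conormal_eqs_iff (al : C) :
  conormal_eqs al <-> forall v, Re (al * Fmap_diff p q a b x v) = 0.
Proof.
  assert (E : forall v, Re (al * Fmap_diff p q a b x v) =
    Re ((al * pow_deriv p z + Cconj (al * a)) * z_coord v
        + (al * pow_deriv q w + Cconj (al * b)) * w_coord v)).
  { intros v. unfold Fmap_diff. fold z w. generalize (pow_deriv p z) (pow_deriv q w). intros A B.
    simpl. ring. }
  unfold conormal_eqs. split.
  - intros [Hz Hw] v. rewrite E, Hz, Hw.
    replace ((- Cconj (al * a) + Cconj (al * a)) * z_coord v
             + (- Cconj (al * b) + Cconj (al * b)) * w_coord v)%C with (RtoC 0) by ring.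
    reflexivity.
  - intros H.
    assert (coeff_z : (al * pow_deriv p z + Cconj (al * a))%C = 0).
    { apply Re_mult_all_eq0. intros m.
      rewrite <- (H (zw_point m 0)), E, z_coord_point, w_coord_point. f_equal. ring. }
    assert (coeff_w : (al * pow_deriv q w + Cconj (al * b))%C = 0).
    { apply Re_mult_all_eq0. intros n.
      rewrite <- (H (zw_point 0 n)), E, z_coord_point, w_coord_point. f_equal. ring. }
    split; apply Ceq_minus; [rewrite <- coeff_z|rewrite <- coeff_w]; ring.
Qed.

Lemma conormal_Fmap (lam : Rn 2 -> R) : conormal dF lam ->
  exists al : C, al <> 0 /\ conormal_eqs al /\ forall c, lam (Rn2_of_C c) = Re (al * c).
Proof.
  intros [linear_lam [[y hy] H]]. destruct (linear_form_Rn2_of_C lam linear_lam) as [al Hal].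
  exists al. split; [|split; [|exact Hal]].
  - intros h. apply hy.
    replace y with (Rn2_of_C (coord y 0, coord y 1)) by exact (mk2_coords y).
    rewrite Hal, h, Cmult_0_l. reflexivity.
  - apply conormal_eqs_iff. intros v. rewrite <- Hal. apply H.
Qed.

Lemma conormal_of_eqs (al : C) : al <> 0 -> conormal_eqs al ->
  exists lam, conormal dF lam /\ forall c, lam (Rn2_of_C c) = Re (al * c).
Proof.
  intros hal Hal. exists (fun y => Re (al * (coord y 0, coord y 1))).
  split; [|intros c; reflexivity]. split; [|split].
  - apply is_linear_ext with (l1 := fun y : Rn 2 => fst al * coord y 0 + - snd al * coord y 1).
    + intros y. simpl. ring.
    + apply is_linear_Rplus; apply is_linear_coord_scal; lia.
  - apply NNPP. intros h. apply hal, Re_mult_all_eq0. intros c.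
    destruct (Req_dec (Re (al * c)) 0) as [e|e]; [exact e|].
    exfalso. apply h. exists (Rn2_of_C c). exact e.
  - intros v. exact (proj1 (conormal_eqs_iff al) Hal v).
Qed.

Lemma conormal_eqs_unit (al u : C) : al <> 0 -> Cmod u = 1 -> Cconj al = (u * al)%C ->
  conormal_eqs al <-> singular_at p q a b z w u.
Proof.
  intros h hu E. unfold conormal_eqs, singular_at. rewrite !Cmult_conj, E. split.
  - intros [Hz Hw]. split; [exact hu|]. split.
    + replace (pow_deriv p z) with (/ al * (al * pow_deriv p z))%C by (field; exact h).
      rewrite Hz. field; exact h.
    + replace (pow_deriv q w) with (/ al * (al * pow_deriv q w))%C by (field; exact h).
      rewrite Hw. field; exact h.
  - intros [_ [Hz Hw]]. rewrite Hz, Hw. split; ring.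
Qed.

Section Conormal.
Context (al : C) (lam : Rn 2 -> R) (hal : al <> 0) (Hal : conormal_eqs al)
  (Hlam : forall c, lam (Rn2_of_C c) = Re (al * c)).

Let A : C := (al * pow_deriv p z)%C.
Let B : C := (al * pow_deriv q w)%C.
Let P : C := (al * pow_deriv2 p z)%C.
Let Q : C := (al * pow_deriv2 q w)%C.

Lemma Fmap_kernel (v : Rn 4) : dF v = zero <-> im_form A B (z_coord v) (w_coord v) = 0.
Proof.
  unfold dF. rewrite Rn2_of_C_eq_zero.
  assert (E : (al * Fmap_diff p q a b x v)%C = (2 * Ci * im_form A B (z_coord v) (w_coord v))%C).
  { unfold im_form. rewrite <- im_alt'. destruct Hal as [Hz Hw]. fold A B in Hz, Hw.
    unfold Fmap_diff. fold z w.
    replace (al * (pow_deriv p z * z_coord v + pow_deriv q w * w_coord v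
        + (a * Cconj (z_coord v) + b * Cconj (w_coord v))))%C
      with (A * z_coord v + B * w_coord v
            + ((al * a) * Cconj (z_coord v) + (al * b) * Cconj (w_coord v)))%C
      by (unfold A, B; ring).
    rewrite Hz, Hw. generalize (al * a)%C (al * b)%C. intros c d.
    rewrite Cplus_conj, !Cmult_conj, !Copp_conj, !Cconj_conj. ring. }
  split; intros H.
  - rewrite H, Cmult_0_r in E. symmetry in E. apply Cmult_integral in E.
    destruct E as [E|E]; [exfalso|apply RtoC_inj, E].
    apply (f_equal Im) in E. simpl in E. lra.
  - rewrite H, Cmult_0_r in E. apply Cmult_integral in E. tauto.
Qed.

Lemma Fmap_hess_plus (v n : Rn 4) :
  lam (QF (plus v n)) = lam (QF v)
    + polar_form P Q (z_coord n) (w_coord n) (z_coord v) (w_coord v) + lam (QF n).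
Proof.
  unfold QF, polar_form. rewrite !Hlam, <- !re_plus. f_equal.
  unfold Fmap_hess, P, Q. fold z w. rewrite z_coord_plus, w_coord_plus. field.
Qed.

Lemma Fmap_hess_polar (n : Rn 4) :
  polar_form P Q (z_coord n) (w_coord n) (z_coord n) (w_coord n) = 2 * lam (QF n).
Proof.
  unfold QF, polar_form. rewrite Hlam, <- re_scal_l. f_equal.
  unfold Fmap_hess, P, Q. fold z w. field.
Qed.

Lemma Fmap_radical_iff (n : Rn 4) :
  hessian_radical dF QF lam n <-> complex_radical A B P Q (z_coord n) (w_coord n).
Proof.
  unfold hessian_radical, complex_radical. rewrite Fmap_kernel. split; intros [hn H].
  - split; [exact hn|]. intros m k hmk.
    assert (hess_n : lam (QF n) = 0).
    { assert (n_invariant : dF zero = zero)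
        by exact (linear_zero _ (is_linear_Fmap_diff p q a b x)).
      apply H in n_invariant. rewrite plus_zero_l in n_invariant. rewrite n_invariant. unfold QF.
      replace (Fmap_hess p q x zero) with (RtoC 0).
      - rewrite Hlam, Cmult_0_r. reflexivity.
      - unfold Fmap_hess. change (z_coord zero) with (RtoC 0).
        change (w_coord zero) with (RtoC 0). ring. }
    specialize (H (zw_point m k)). rewrite Fmap_kernel, z_coord_point, w_coord_point in H.
    specialize (H hmk). rewrite Fmap_hess_plus, z_coord_point, w_coord_point in H. lra.
  - split; [exact hn|]. intros v hv. apply Fmap_kernel in hv.
    rewrite Fmap_hess_plus, (H _ _ hv).
    specialize (H _ _ hn). rewrite Fmap_hess_polar in H. lra.
Qed.

Context (Hjet : fold_or_cusp_jet dF QF) (Hconormal : conormal dF lam).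
Context (hp : (2 <= p)%nat) (hq : (2 <= q)%nat).

Lemma fold_or_cusp_pow_deriv2_neq0 : pow_deriv2 p z <> 0 /\ pow_deriv2 q w <> 0.
Proof.
  destruct Hjet as [_ [_ H]]. destruct (H lam Hconormal) as [n0 Hn0].
  assert (in_line : forall m n, complex_radical A B P Q m n ->
    exists s : R, zw_point m n = scal s n0).
  { intros m n hmn. apply Hn0, Fmap_radical_iff. rewrite z_coord_point, w_coord_point. exact hmn. }
  split; intros h.
  - assert (hP : P = 0) by (unfold P; rewrite h; ring).
    assert (hA : A = 0) by (unfold A; rewrite (pow_deriv_eq0_of_deriv2 p z hp h); ring).
    assert (radical_axis : forall m, complex_radical A B P Q m 0)
      by (intros m; rewrite hA, hP; apply complex_radical_of_zero_coeffs).
    destruct (in_line _ _ (radical_axis 1)) as [s Hs].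
    destruct (in_line _ _ (radical_axis Ci)) as [t Ht].
    pose proof (collinear_minor 4 0 1 _ _ n0 s t ltac:(lia) ltac:(lia) Hs Ht) as minor.
    unfold coord in minor. simpl in minor. lra.
  - assert (hQ : Q = 0) by (unfold Q; rewrite h; ring).
    assert (hB : B = 0) by (unfold B; rewrite (pow_deriv_eq0_of_deriv2 q w hq h); ring).
    assert (radical_axis : forall n, complex_radical A B P Q 0 n).
    { intros n. apply complex_radical_swap. rewrite hB, hQ. apply complex_radical_of_zero_coeffs. }
    destruct (in_line _ _ (radical_axis 1)) as [s Hs].
    destruct (in_line _ _ (radical_axis Ci)) as [t Ht].
    pose proof (collinear_minor 4 2 3 _ _ n0 s t ltac:(lia) ltac:(lia) Hs Ht) as minor.
    unfold coord in minor. simpl in minor. lra.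
Qed.

Lemma fold_or_cusp_linear_part_neq0 : A <> 0 \/ B <> 0.
Proof.
  destruct (Ceq_dec A 0) as [hA|hA]; [|auto]. destruct (Ceq_dec B 0) as [hB|hB]; [|auto].
  exfalso. destruct Hjet as [[v hv] _]. apply hv, Fmap_kernel. unfold im_form.
  rewrite hA, hB, !Cmult_0_l, Cplus_0_r. reflexivity.
Qed.

Lemma discriminant_cusp_form :
  (RtoC (INR (p - 1) * INR (q - 1)) * discriminant A B P Q)%C = (al * cusp_form p q z w)%C.
Proof.
  destruct fold_or_cusp_pow_deriv2_neq0 as [hz hw].
  unfold discriminant, cusp_form, A, B, P, Q.
  replace (INR p * INR (q - 1) * z ^ p)%C
    with (INR (q - 1) * (INR p * z ^ p * pow_deriv2 p z) / pow_deriv2 p z)%C by (field; exact hz).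
  replace (INR q * INR (p - 1) * w ^ q)%C
    with (INR (p - 1) * (INR q * w ^ q * pow_deriv2 q w) / pow_deriv2 q w)%C by (field; exact hw).
  rewrite <- !pow_deriv_sqr by assumption. rewrite RtoC_mult. field. auto.
Qed.

Lemma radical_nontrivial_iff_cusp_form (u : C) : Cconj al = (u * al)%C ->
  (exists n, hessian_radical dF QF lam n /\ n <> zero) <->
  (cusp_form p q z w + u * Cconj (cusp_form p q z w))%C = 0.
Proof.
  intros E. destruct fold_or_cusp_pow_deriv2_neq0 as [hz hw].
  rewrite <- (Re_mult_eq0_iff al u _ hal E), <- discriminant_cusp_form, re_scal_l.
  transitivity (Re (discriminant A B P Q) = 0).
  - rewrite <- complex_radical_nontrivial_iff;
      [|apply Cmult_neq_0; assumption..|exact fold_or_cusp_linear_part_neq0].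
    split.
    + intros [n [Hn hn]]. exists (z_coord n), (w_coord n). split; [apply Fmap_radical_iff, Hn|].
      destruct (Ceq_dec (z_coord n) 0) as [nz|nz]; [right|auto].
      intros nw. apply hn. rewrite <- (zw_point_coords n), nz, nw. exact zw_point_0.
    + intros [m [n [H h]]]. exists (zw_point m n). split.
      * apply Fmap_radical_iff. rewrite z_coord_point, w_coord_point. exact H.
      * intros e. destruct h as [h|h]; apply h.
        -- rewrite <- (z_coord_point m n), e. reflexivity.
        -- rewrite <- (w_coord_point m n), e. reflexivity.
  - assert (hn : INR (p - 1) * INR (q - 1) <> 0)
      by (apply Rmult_integral_contrapositive_currified; apply not_0_INR; lia).
    split; intros H; [rewrite H; ring|]. apply Rmult_integral in H. tauto.
Qed.

End Conormal.
End ConormalsOfFmap.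

Section ExcellentFmap.
Context (p q : nat) (a b : C) (hp : (2 <= p)%nat) (hq : (2 <= q)%nat).
Context (exc : excellent (Fmap p q a b)).

Let F := Fmap p q a b.
Let dF (x v : Rn 4) : Rn 2 := Rn2_of_C (Fmap_diff p q a b x v).
Let QF (x v : Rn 4) : Rn 2 := Rn2_of_C (Fmap_hess p q x v).
Let jet_F : forall x, jet2 F x (dF x) (QF x) := Fmap_jet2 p q a b.

Lemma singular_at_conormal (x : Rn 4) (u : C) : singular_at p q a b (z_coord x) (w_coord x) u ->
  exists (al : C) (lam : Rn 2 -> R),
    al <> 0 /\ Cconj al = (u * al)%C /\ conormal_eqs p q a b x al /\
    (forall c, lam (Rn2_of_C c) = Re (al * c)) /\ conormal (dF x) lam.
Proof.
  intros Hu. destruct (conj_eq_unit_mult u (proj1 Hu)) as [al [hal E]].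
  assert (Hal : conormal_eqs p q a b x al)
    by (apply (conormal_eqs_unit p q a b x al u); auto; apply Hu).
  destruct (conormal_of_eqs p q a b x al hal Hal) as [lam [Hlam Hform]].
  exists al, lam. auto.
Qed.

Lemma excellent_conormal_cases (x : Rn 4) (lam : Rn 2 -> R) : conormal (dF x) lam ->
  fold_or_cusp_jet (dF x) (QF x) /\ (is_cusp F x <-> degenerate_jet (dF x) (QF x)).
Proof.
  intros Hlam.
  assert (fold : forall e3, e3 <> 0 -> local_form F x (fold_cusp_form 1 e3 0) ->
    fold_or_cusp_jet (dF x) (QF x) /\ (is_cusp F x <-> degenerate_jet (dF x) (QF x))).
  { intros e3 he3 H.
    destruct (fold_cusp_form_jets F dF QF jet_F 1 e3 0 x R1_neq_R0 H) as [Hjet Hdeg].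
    split; [exact Hjet|]. rewrite Hdeg. split; [|contradiction].
    intros Hc. apply Hdeg, (cusp_jet F dF QF jet_F x Hc). }
  destruct exc as [_ H]. destruct (H x) as [h|[h|[h|h]]].
  - exfalso. exact (regular_no_conormal F dF QF jet_F x lam h Hlam).
  - apply (fold 1); [lra|]. rewrite <- nf_def_fold_eq. exact h.
  - apply (fold (-1)); [lra|]. rewrite <- nf_indef_fold_eq. exact h.
  - destruct (cusp_jet F dF QF jet_F x h) as [Hjet Hdeg]. tauto.
Qed.

Lemma is_cusp_iff (x : Rn 4) : is_cusp F x <-> cusp_eqs p q a b (z_coord x) (w_coord x).
Proof.
  split.
  - intros Hc. destruct (cusp_jet F dF QF jet_F x Hc) as [Hjet [lam [n [Hlam Hn]]]].
    destruct (conormal_Fmap p q a b x lam Hlam) as [al [hal [Hal Hform]]].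
    destruct (unit_conj_quotient al hal) as [u [hu E]].
    exists u. split; [apply (conormal_eqs_unit p q a b x al u); assumption|].
    apply (radical_nontrivial_iff_cusp_form p q a b x al lam hal Hal Hform Hjet Hlam hp hq u E).
    exists n. exact Hn.
  - intros [u [Hu Hform]].
    destruct (singular_at_conormal x u Hu) as [al [lam [hal [E [Hal [Hlam Hconormal]]]]]].
    destruct (excellent_conormal_cases x lam Hconormal) as [Hjet Hcusp]. apply Hcusp.
    destruct (proj2 (radical_nontrivial_iff_cusp_form p q a b x al lam hal Hal Hlam Hjet
      Hconormal hp hq u E) Hform) as [n Hn].
    exists lam, n. auto.
Qed.

Lemma singular_at_pow_deriv2_neq0 (x : Rn 4) (u : C) :
  singular_at p q a b (z_coord x) (w_coord x) u ->
  pow_deriv2 p (z_coord x) <> 0 /\ pow_deriv2 q (w_coord x) <> 0.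
Proof.
  intros Hu. destruct (singular_at_conormal x u Hu) as [al [lam [hal [_ [Hal [Hlam Hconormal]]]]]].
  destruct (excellent_conormal_cases x lam Hconormal) as [Hjet _].
  exact (fold_or_cusp_pow_deriv2_neq0 p q a b x al lam hal Hal Hlam Hjet Hconormal hp hq).
Qed.

Lemma excellent_coeffs : a <> 0 \/ b <> 0.
Proof.
  destruct (Ceq_dec a 0) as [ha|ha]; [|auto]. destruct (Ceq_dec b 0) as [hb|hb]; [|auto].
  assert (singular_0 : singular_at p q a b (z_coord zero) (w_coord zero) 1).
  { split; [apply Cmod_1|].
    change (z_coord zero) with (RtoC 0). change (w_coord zero) with (RtoC 0).
    rewrite ha, hb, Cconj_0, !pow_deriv_0 by assumption. split; ring. }
  destruct (singular_at_conormal zero 1 singular_0) as [al [lam [hal [_ [Hal [_ Hlam]]]]]].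
  destruct (excellent_conormal_cases zero lam Hlam) as [Hjet _].
  destruct (fold_or_cusp_linear_part_neq0 p q a b zero al hal Hal Hjet) as [h|h];
    exfalso; apply h.
  - change (z_coord zero) with (RtoC 0). rewrite pow_deriv_0 by exact hp. ring.
  - change (w_coord zero) with (RtoC 0). rewrite pow_deriv_0 by exact hq. ring.
Qed.

End ExcellentFmap.

(** * Roots of complex polynomials and of trigonometric sums *)

Fixpoint poly_deg_le (n : nat) (f : C -> C) : Prop :=
  match n with
  | O => exists c, forall y, f y = c
  | S k => exists c g, poly_deg_le k g /\ forall y, f y = (c + y * g y)%C
  end.

Lemma poly_deg_le_S (n : nat) : forall f, poly_deg_le n f -> poly_deg_le (S n) f.
Proof.
  induction n as [|n IH]; intros f.
  - intros [c H]. exists c, (fun _ => RtoC 0). split; [exists 0; reflexivity|].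
    intros y. rewrite H. ring.
  - intros [c [g [Hg H]]]. exists c, g. split; [apply IH, Hg|exact H].
Qed.

Lemma poly_deg_le_plus (n : nat) : forall f g, poly_deg_le n f -> poly_deg_le n g ->
  poly_deg_le n (fun y => f y + g y)%C.
Proof.
  induction n as [|n IH]; intros f g.
  - intros [c H] [c' H']. exists (c + c')%C. intros y. rewrite H, H'. reflexivity.
  - intros [c [h [Hh H]]] [c' [h' [Hh' H']]].
    exists (c + c')%C, (fun y => h y + h' y)%C. split; [apply IH; assumption|].
    intros y. rewrite H, H'. ring.
Qed.

Lemma poly_deg_le_scal (n : nat) (s : C) :
  forall f, poly_deg_le n f -> poly_deg_le n (fun y => s * f y)%C.
Proof.
  induction n as [|n IH]; intros f.
  - intros [c H]. exists (s * c)%C. intros y. rewrite H. reflexivity.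
  - intros [c [h [Hh H]]]. exists (s * c)%C, (fun y => s * h y)%C.
    split; [apply IH; assumption|]. intros y. rewrite H. ring.
Qed.

Lemma poly_deg_le_monomial (n k : nat) (s : C) :
  (k <= n)%nat -> poly_deg_le n (fun y => s * y ^ k)%C.
Proof.
  revert k. induction n as [|n IH]; intros k hk.
  - exists s. intros y. replace k with 0%nat by lia. simpl. ring.
  - destruct k as [|k]; [apply poly_deg_le_S, IH; lia|].
    exists 0, (fun y => s * y ^ k)%C. split; [apply IH; lia|]. intros y. rewrite Cpow_S. ring.
Qed.

Lemma poly_deg_le_factor (n : nat) (r : C) : forall f, poly_deg_le (S n) f ->
  exists h, poly_deg_le n h /\ forall y, f y = (f r + (y - r) * h y)%C.
Proof.
  induction n as [|n IH]; intros f [c [g [Hg H]]].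
  - destruct Hg as [d Hd]. exists (fun _ => d). split; [exists d; reflexivity|].
    intros y. rewrite !H, !Hd. ring.
  - destruct (IH g Hg) as [h [Hh E]]. exists (fun y => g y + r * h y)%C. split.
    + apply poly_deg_le_plus; [exact Hg|]. apply poly_deg_le_S, poly_deg_le_scal, Hh.
    + intros y. rewrite !H, (E y). ring.
Qed.

Lemma poly_deg_le_roots (n : nat) : forall (f : C -> C) (l : list C) (y0 : C),
  poly_deg_le n f -> f y0 <> 0 -> NoDup l -> (forall y, In y l -> f y = 0) ->
  (length l <= n)%nat.
Proof.
  induction n as [|n IH]; intros f [|r l] y0 Hf h0 Hl H; try (simpl; lia).
  - exfalso. destruct Hf as [c Hc]. apply h0. rewrite Hc, <- (Hc r). apply H. left. reflexivity.
  - destruct (poly_deg_le_factor n r f Hf) as [h [Hh E]].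
    assert (fr : f r = 0) by (apply H; left; reflexivity).
    apply NoDup_cons_iff in Hl. destruct Hl as [hr Hl].
    simpl. apply le_n_S. apply (IH h l y0); auto.
    + intros hy0. apply h0. rewrite E, fr, hy0. ring.
    + intros y hy. assert (fy : f y = 0) by (apply H; right; exact hy).
      rewrite E, fr, Cplus_0_l in fy. apply Cmult_integral in fy.
      destruct fy as [fy|fy]; [|exact fy]. exfalso. apply hr.
      rewrite <- (proj2 (Ceq_minus y r) fy). exact hy.
Qed.

Lemma list_of_bounded_set {A : Type} (P : A -> Prop) (n : nat) :
  (forall l, NoDup l -> (forall x, In x l -> P x) -> (length l <= n)%nat) ->
  exists l, NoDup l /\ forall x, In x l <-> P x.
Proof.
  intros H.
  assert (enumerate : forall k, (exists l, NoDup l /\ forall x, In x l <-> P x) \/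
     exists l, NoDup l /\ (forall x, In x l -> P x) /\ length l = k).
  { induction k as [|k [IH|[l [Hl [HP Hk]]]]]; [|left; exact IH|].
    - right. exists nil. split; [constructor|]. split; [intros x []|reflexivity].
    - destruct (classic (exists x, P x /\ ~ In x l)) as [[x [hx hn]]|hn].
      + right. exists (x :: l). split; [constructor; assumption|].
        split; [intros y [<-|hy]; auto|simpl; lia].
      + left. exists l. split; [exact Hl|]. intros x. split; [apply HP|].
        intros hx. apply NNPP. intros h. apply hn. exists x. auto. }
  destruct (enumerate (S n)) as [h|[l [Hl [HP Hk]]]]; [exact h|].
  specialize (H l Hl HP). lia.
Qed.

Definition cis (x : R) : C := (cos x, sin x).

Lemma cis_plus (x y : R) : cis (x + y) = (cis x * cis y)%C.
Proof. unfold cis, Cmult; simpl. rewrite cos_plus, sin_plus. f_equal; ring. Qed.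

Lemma cis_0 : cis 0 = 1.
Proof. unfold cis. rewrite cos_0, sin_0. reflexivity. Qed.

Lemma cis_pow (x : R) (n : nat) : (cis x ^ n)%C = cis (INR n * x).
Proof.
  induction n as [|n IH]; [simpl; rewrite Rmult_0_l, cis_0; reflexivity|].
  rewrite Cpow_S, IH, <- cis_plus, S_INR. f_equal. ring.
Qed.

Lemma Cmod_cis (x : R) : Cmod (cis x) = 1.
Proof.
  unfold Cmod, cis. replace (_ + _) with 1; [apply sqrt_1|].
  simpl. pose proof (sin2_cos2 x). unfold Rsqr in *. lra.
Qed.

Lemma Cconj_cis (x : R) : Cconj (cis x) = cis (- x).
Proof. unfold Cconj, cis; simpl. rewrite cos_neg, sin_neg. reflexivity. Qed.

Lemma cis_period (x : R) (k : nat) : cis (x + 2 * INR k * PI) = cis x.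
Proof. unfold cis. rewrite cos_period, sin_period. reflexivity. Qed.

Lemma Cmod_cis_minus_1_sqr (x : R) : Cmod (cis x - 1) ^ 2 = 4 * sin (x / 2) ^ 2.
Proof.
  rewrite Cmod2_alt. simpl. replace x with (2 * (x / 2)) at 1 2 3 4 by field.
  rewrite cos_2a_sin, sin_2a. pose proof (sin2_cos2 (x / 2)). unfold Rsqr in *. nra.
Qed.

Lemma Cmod_cis_minus_1_le (x : R) : 0 <= x <= 2 * PI -> Cmod (cis x - 1) <= x.
Proof.
  intros hx. pose proof (Cmod_cis_minus_1_sqr x). pose proof (Cmod_ge_0 (cis x - 1)).
  assert (hs : 0 <= sin (x / 2) <= x / 2).
  { split; [apply sin_ge_0; lra|]. destruct (Req_dec x 0) as [->|h0].
    - replace (0 / 2) with 0 by field. rewrite sin_0. lra.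
    - apply Rlt_le, sin_lt_x. lra. }
  apply Rnot_lt_le. intros hlt. nra.
Qed.

Lemma small_rotation (B M d : R) : 0 <= B -> 0 < M -> 0 < d ->
  exists t, 0 < t /\ forall (c : C) r, Cmod c <= B -> 0 < r <= M ->
    r * t <= 1 /\ Cmod (c * cis (r * t) - c) < d.
Proof.
  intros hB hM hd.
  assert (hm : 0 < Rmin 1 d) by (apply Rmin_glb_lt; lra).
  assert (hMB : 0 <= M * B) by (apply Rmult_le_pos; lra).
  pose proof (Rmin_l 1 d). pose proof (Rmin_r 1 d). pose proof PI2_1.
  set (t := Rmin 1 d / (M * B + M + 1)). assert (ht : 0 < t) by (apply Rdiv_lt_0_compat; lra).
  assert (Et : t * (M * B) + M * t + t = Rmin 1 d) by (unfold t; field; lra).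
  exists t. split; [exact ht|]. intros c r hc hr.
  assert (hMt : 0 <= t * (M * B)) by (apply Rmult_le_pos; lra).
  assert (hrt : 0 < r * t <= M * t)
    by (split; [apply Rmult_lt_0_compat|apply Rmult_le_compat_r]; lra).
  split; [lra|].
  replace (c * cis (r * t) - c)%C with (c * (cis (r * t) - 1))%C by ring. rewrite Cmod_mult.
  apply Rle_lt_trans with (B * (M * t)); [|lra].
  apply Rmult_le_compat; try apply Cmod_ge_0; [exact hc|].
  eapply Rle_trans; [apply Cmod_cis_minus_1_le; lra|]. lra.
Qed.

Lemma cis_neq_1 (x : R) : 0 < x < 2 * PI -> cis x <> 1.
Proof.
  intros hx E. pose proof (Cmod_cis_minus_1_sqr x) as norm_sqr. rewrite E in norm_sqr.
  replace (1 - 1)%C with (RtoC 0) in norm_sqr by ring. rewrite Cmod_0 in norm_sqr.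
  assert (0 < sin (x / 2)) by (apply sin_gt_0; lra). nra.
Qed.

Lemma cis_inj (x0 x y : R) : x0 <= x < x0 + 2 * PI -> x0 <= y < x0 + 2 * PI ->
  cis x = cis y -> x = y.
Proof.
  assert (cis_neq : forall x y, x < y < x + 2 * PI -> cis x <> cis y).
  { clear. intros x y h E. apply (cis_neq_1 (y - x)); [lra|].
    unfold Rminus. rewrite cis_plus, <- E, <- cis_plus, Rplus_opp_r. exact cis_0. }
  intros hx hy E. destruct (Rtotal_order x y) as [h|[h|h]]; [|exact h|]; exfalso.
  - apply (cis_neq x y); [lra|exact E].
  - apply (cis_neq y x); [lra|auto].
Qed.

Lemma unit_polar (c : C) : Cmod c = 1 -> exists x, c = cis x.
Proof.
  intros H. destruct c as [x y].
  assert (E : x ^ 2 + y ^ 2 = 1).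
  { pose proof (Cmod2_alt (x, y)) as E. rewrite H in E. simpl in E. simpl. lra. }
  assert (hx : -1 <= x <= 1) by nra.
  assert (hs : sin (acos x) ^ 2 = y ^ 2).
  { pose proof (sin2_cos2 (acos x)) as pythagoras. rewrite cos_acos in pythagoras by exact hx.
    unfold Rsqr in pythagoras. lra. }
  assert (hp : 0 <= sin (acos x)) by (pose proof (acos_bound x); apply sin_ge_0; lra).
  destruct (Rle_dec 0 y) as [hy|hy].
  - exists (acos x). unfold cis. rewrite cos_acos by exact hx. f_equal. nra.
  - exists (- acos x). unfold cis. rewrite cos_neg, sin_neg, cos_acos by exact hx. f_equal. nra.
Qed.

Lemma polar (c : C) : exists x, c = (Cmod c * cis x)%C.
Proof.
  destruct (Ceq_dec c 0) as [->|h]; [exists 0; rewrite Cmod_0; ring|].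
  assert (hm : RtoC (Cmod c) <> 0).
  { intros e. apply RtoC_inj in e. apply Cmod_gt_0 in h. lra. }
  destruct (unit_polar (c / Cmod c)%C) as [x Hx].
  - rewrite Cmod_div, Cmod_R, Rabs_pos_eq; [|apply Cmod_ge_0|exact hm].
    field. apply Rgt_not_eq, Cmod_gt_0, h.
  - exists x. rewrite <- Hx. field. exact hm.
Qed.

Lemma pos_root (n : nat) (c : R) : (0 < n)%nat -> 0 < c -> exists r, 0 < r /\ r ^ n = c.
Proof.
  intros hn hc. exists (Rpower c (/ INR n)). split; [apply exp_pos|].
  rewrite <- Rpower_pow by apply exp_pos. rewrite Rpower_mult, Rinv_l, Rpower_1; auto.
  apply not_0_INR; lia.
Qed.

Lemma pow_incr_strict (n : nat) (x y : R) : (0 < n)%nat -> 0 <= x -> x < y -> x ^ n < y ^ n.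
Proof.
  intros hn hx h. induction n as [|[|n] IH]; [lia|simpl; lra|].
  specialize (IH ltac:(lia)). change (x * x ^ S n < y * y ^ S n).
  assert (0 <= x ^ S n) by (apply pow_le, hx). nra.
Qed.

Lemma pow_inj_nonneg (n : nat) (x y : R) :
  (0 < n)%nat -> 0 <= x -> 0 <= y -> x ^ n = y ^ n -> x = y.
Proof.
  intros hn hx hy E. destruct (Rtotal_order x y) as [h|[h|h]]; [|exact h|];
    apply (pow_incr_strict n) in h; try assumption; lra.
Qed.

Lemma pow_roots_lower (n : nat) (c : C) : (0 < n)%nat -> c <> 0 ->
  exists l, NoDup l /\ length l = n /\ forall y, In y l -> (y ^ n)%C = c.
Proof.
  intros hn hc. destruct (polar c) as [x Hx].
  destruct (pos_root n (Cmod c) hn (proj1 (Cmod_gt_0 c) hc)) as [r [hr Hr]].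
  assert (hr' : RtoC r <> 0) by (intros e; apply RtoC_inj in e; lra).
  assert (hN : 0 < INR n) by (apply lt_0_INR, hn).
  pose proof PI_RGT_0 as hpi.
  set (arg := fun k : nat => x / INR n + 2 * PI * (INR k / INR n)).
  exists (map (fun k => r * cis (arg k))%C (seq 0 n)). split; [|split].
  - apply Injective_map_NoDup_in; [|apply seq_NoDup].
    intros i j hi hj E. apply in_seq in hi, hj.
    assert (range : forall k, (k < n)%nat -> x / INR n <= arg k < x / INR n + 2 * PI).
    { intros k hk. apply lt_INR in hk. pose proof (pos_INR k).
      assert (0 <= INR k / INR n < 1); [|unfold arg; nra].
      split; [apply Rdiv_le_0_compat; lra|]. apply (Rdiv_lt_1 (INR k)); lra. }
    assert (E' : arg i = arg j).
    { apply (cis_inj (x / INR n)); try (apply range; lia).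
      replace (cis (arg i)) with (/ r * (r * cis (arg i)))%C by (field; exact hr').
      rewrite E. field. exact hr'. }
    apply INR_eq. unfold arg in E'. apply Rplus_eq_reg_l, Rmult_eq_reg_l in E'; [|lra].
    apply Rmult_eq_reg_r in E'; [exact E'|]. apply Rinv_neq_0_compat. lra.
  - rewrite length_map. apply length_seq.
  - intros y hy. apply in_map_iff in hy. destruct hy as [k [<- _]].
    rewrite Cpow_mult_l, cis_pow, <- RtoC_pow, Hr.
    replace (INR n * arg k) with (x + 2 * INR k * PI) by (unfold arg; field; lra).
    rewrite cis_period. symmetry. exact Hx.
Qed.

Lemma pow_roots (n : nat) (c : C) : (0 < n)%nat -> c <> 0 ->
  exists l, NoDup l /\ length l = n /\ forall y, In y l <-> (y ^ n)%C = c.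
Proof.
  intros hn hc. destruct (pow_roots_lower n c hn hc) as [l [Hl [Hlen Hroot]]].
  exists l. split; [exact Hl|]. split; [exact Hlen|]. intros v. split; [apply Hroot|].
  intros hv. apply NNPP. intros hnin.
  assert (too_many : (length (v :: l) <= n)%nat); [|simpl in too_many; lia].
  apply (poly_deg_le_roots n (fun t => 1 * t ^ n + (- c) * t ^ 0)%C (v :: l) 0).
  - apply poly_deg_le_plus; apply poly_deg_le_monomial; lia.
  - replace n with (S (n - 1)) by lia. rewrite Cpow_S. intros value_0. apply hc.
    replace c with (- (1 * (0 * 0 ^ (n - 1)) + - c * 0 ^ 0))%C by ring. rewrite value_0. ring.
  - constructor; assumption.
  - intros t [<-|ht]; [rewrite hv|rewrite (Hroot t ht)]; simpl; ring.
Qed.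

Lemma alternating_zeros (f : R -> R) (x0 h : R) (n : nat) :
  continuity f -> 0 < h ->
  (forall k, (k < n)%nat -> f (x0 + INR k * h) * f (x0 + INR (S k) * h) < 0) ->
  exists l, NoDup l /\ length l = n /\
    forall x, In x l -> x0 <= x < x0 + INR n * h /\ f x = 0.
Proof.
  intros Hc hh. induction n as [|n IH]; intros H.
  - exists nil. split; [constructor|]. split; [reflexivity|intros x []].
  - destruct IH as [l [Hl [Hn Hz]]]; [intros k hk; apply H; lia|].
    specialize (H n ltac:(lia)). rewrite S_INR in *.
    pose proof (pos_INR n) as hn0.
    destruct (IVT_cor f (x0 + INR n * h) (x0 + (INR n + 1) * h) Hc) as [x [hx fx]]; [lra|lra|].
    assert (x <> x0 + INR n * h) by (intros e; rewrite <- e, fx in H; lra).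
    assert (x <> x0 + (INR n + 1) * h) by (intros e; rewrite <- e, fx in H; lra).
    exists (x :: l). split; [|split; [simpl; lia|]].
    + constructor; [|exact Hl]. intros hin. destruct (Hz x hin) as [[_ hlt] _]. lra.
    + intros y [<-|hy]; [split; [nra|exact fx]|].
      destruct (Hz y hy) as [range zero]. split; [nra|exact zero].
Qed.

Lemma cos_INR_PI (k : nat) : cos (INR k * PI) = 1 \/ cos (INR k * PI) = - 1.
Proof.
  induction k as [|k IH]; [left; simpl; rewrite Rmult_0_l; exact cos_0|].
  rewrite S_INR, Rmult_plus_distr_r, Rmult_1_l, neg_cos. lra.
Qed.

Lemma continuity_cos_affine (Y c s : R) : continuity (fun x => Y * cos (c + s * x)).
Proof.
  intros x. apply derivable_continuous_pt, ex_derive_Reals_0. auto_derive. exact I.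
Qed.

(* The sign alternates at the extrema of the leading cosine. *)
Lemma perturbed_cos_zeros (X Y c : R) (g : R -> R) (m : nat) :
  Y < X -> (0 < m)%nat -> continuity g -> (forall x, Rabs (g x) <= Y) ->
  exists x0 l, NoDup l /\ length l = m /\ forall x, In x l ->
    x0 <= x < x0 + 2 * PI /\ X * cos (c + INR m / 2 * x) + g x = 0.
Proof.
  intros hXY hm Hg HY.
  assert (hM : 0 < INR m) by (apply lt_0_INR, hm).
  pose proof PI_RGT_0 as hpi.
  set (x0 := - 2 * c / INR m). set (h := 2 * PI / INR m).
  destruct (alternating_zeros (fun x => X * cos (c + INR m / 2 * x) + g x) x0 h m)
    as [l [Hl [Hn Hz]]].
  - exact (continuity_plus _ g (continuity_cos_affine X c (INR m / 2)) Hg).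
  - apply Rdiv_lt_0_compat; lra.
  - intros k _.
    replace (c + INR m / 2 * (x0 + INR k * h)) with (INR k * PI) by (unfold x0, h; field; lra).
    replace (c + INR m / 2 * (x0 + INR (S k) * h)) with (INR k * PI + PI)
      by (rewrite S_INR; unfold x0, h; field; lra).
    rewrite neg_cos. generalize (x0 + INR k * h) (x0 + INR (S k) * h). intros s t.
    pose proof (proj1 (Rabs_le_between (g s) Y) (HY s)).
    pose proof (proj1 (Rabs_le_between (g t) Y) (HY t)).
    destruct (cos_INR_PI k) as [E|E]; rewrite E; nra.
  - exists x0, l. split; [exact Hl|]. split; [exact Hn|].
    replace (INR m * h) with (2 * PI) in Hz by (unfold h; field; lra). exact Hz.
Qed.

Lemma Rabs_cos_le (Y t : R) : 0 <= Y -> Rabs (Y * cos t) <= Y.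
Proof.
  intros hY. rewrite Rabs_mult, (Rabs_pos_eq Y) by exact hY.
  assert (Rabs (cos t) <= 1) by (apply Rabs_le, COS_bound). nra.
Qed.

(* If [X = Y] the sum is a product of cosines; otherwise the larger term decides
   the sign at its extrema. *)
Lemma two_cos_zeros (X Y c c' : R) (m k : nat) :
  0 < X -> 0 <= Y -> (0 < m)%nat ->
  exists x0 l, NoDup l /\ (m <= length l)%nat /\ forall x, In x l ->
    x0 <= x < x0 + 2 * PI /\
    X * cos (c + INR m / 2 * x) + Y * cos (c' + INR (m + 2 * k) / 2 * x) = 0.
Proof.
  intros hX hY hm. destruct (Rtotal_order X Y) as [h|[<-|h]].
  - destruct (perturbed_cos_zeros Y X c' (fun x => X * cos (c + INR m / 2 * x)) (m + 2 * k))
      as [x0 [l [Hl [Hn Hz]]]]; [exact h|lia|apply continuity_cos_affine|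
        intros x; apply Rabs_cos_le; lra|].
    exists x0, l. split; [exact Hl|]. split; [lia|]. intros x hx.
    destruct (Hz x hx) as [range zero]. split; [exact range|]. rewrite Rplus_comm. exact zero.
  - destruct (perturbed_cos_zeros 1 0 ((c + c') / 2) (fun _ => 0) (m + k))
      as [x0 [l [Hl [Hn Hz]]]]; [lra|lia|apply continuity_const; intros ? ?; reflexivity|
        intros x; rewrite Rabs_R0; lra|].
    exists x0, l. split; [exact Hl|]. split; [lia|]. intros x hx.
    destruct (Hz x hx) as [range zero]. split; [exact range|].
    rewrite <- Rmult_plus_distr_l, form1.
    replace ((c + INR m / 2 * x + (c' + INR (m + 2 * k) / 2 * x)) / 2)
      with ((c + c') / 2 + INR (m + k) / 2 * x)
      by (rewrite !plus_INR, mult_INR; simpl (INR 2); field).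
    replace (cos ((c + c') / 2 + INR (m + k) / 2 * x)) with 0 by lra. ring.
  - destruct (perturbed_cos_zeros X Y c (fun x => Y * cos (c' + INR (m + 2 * k) / 2 * x)) m)
      as [x0 [l [Hl [Hn Hz]]]]; [exact h|lia|apply continuity_cos_affine|
        intros x; apply Rabs_cos_le, hY|].
    exists x0, l. split; [exact Hl|]. split; [lia|]. exact Hz.
Qed.

Lemma list_of_relation {A B : Type} (rel : A -> B -> Prop) (lo hi : nat) (lA : list A) :
  NoDup lA ->
  (forall x, In x lA -> exists l, NoDup l /\ (lo <= length l <= hi)%nat /\
     forall y, In y l <-> rel x y) ->
  exists L : list (A * B), NoDup L /\
    (length lA * lo <= length L <= length lA * hi)%nat /\
    forall x y, In (x, y) L <-> In x lA /\ rel x y.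
Proof.
  intros Hnd. induction Hnd as [|x0 lA hx0 Hnd IH]; intros H.
  - exists nil. split; [constructor|]. split; [simpl; lia|]. intros x y. simpl. tauto.
  - destruct IH as [L [HL [Hn HL']]]; [intros x hx; apply H; right; exact hx|].
    destruct (H x0) as [l [Hl [Hm Hl']]]; [left; reflexivity|].
    exists (map (pair x0) l ++ L). split; [|split].
    + apply NoDup_app; [|exact HL|].
      * apply Injective_map_NoDup; [|exact Hl]. intros y y' E. congruence.
      * intros [x y] h h'. apply in_map_iff in h. destruct h as [y' [E _]].
        apply HL' in h'. destruct h' as [h' _]. congruence.
    + rewrite length_app, length_map. simpl. lia.
    + intros x y. rewrite in_app_iff, in_map_iff, HL'. simpl. split.
      * intros [[y' [E hy]]|[hx hy]]; [|auto].
        injection E as <- <-. split; [auto|apply Hl', hy].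
      * intros [[<-|hx] hy]; [|auto]. left. exists y. split; [reflexivity|apply Hl', hy].
Qed.

Lemma count_of_constant_fibres {A B : Type} (decB : forall x y : B, {x = y} + {x <> y})
  (f : A -> B) (lA : list A) (P : B -> Prop) (n : nat) :
  (0 < n)%nat -> NoDup lA -> (forall x, In x lA -> P (f x)) ->
  (forall y, P y -> exists l, NoDup l /\ length l = n /\
     forall x, In x l <-> In x lA /\ f x = y) ->
  exists lB, NoDup lB /\ (forall y, In y lB <-> P y) /\ (length lB * n)%nat = length lA.
Proof.
  intros hn HA HP Hf. set (lB := nodup decB (map f lA)).
  assert (Hin : forall y, In y lB <-> P y).
  { intros y. unfold lB. rewrite nodup_In, in_map_iff. split.
    - intros [x [<- hx]]. apply HP, hx.
    - intros hy. destruct (Hf y hy) as [[|x l] [_ [Hl H]]]; [simpl in Hl; lia|].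
      destruct (proj1 (H x) (or_introl eq_refl)) as [hx hfx]. exists x. auto. }
  exists lB. split; [apply NoDup_nodup|]. split; [exact Hin|].
  destruct (list_of_relation (fun y x => In x lA /\ f x = y) n n lB) as [L [HL [Hlen HL']]].
  { apply NoDup_nodup. }
  { intros y hy. apply Hin in hy. destruct (Hf y hy) as [l [Hl [Hn Hfibre]]].
    exists l. split; [exact Hl|]. split; [lia|exact Hfibre]. }
  assert (Hgraph : length L = length lA); [|lia].
  transitivity (length (map (fun x => (f x, x)) lA)); [|apply length_map].
  assert (same : forall yx, In yx L <-> In yx (map (fun x => (f x, x)) lA)).
  { intros [y x]. rewrite HL', in_map_iff. split.
    - intros [_ [hx <-]]. exists x. auto.
    - intros [x' [E hx']]. injection E as <- <-. split; [apply Hin, HP, hx'|auto]. }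
  assert (Hgraph_uniq : NoDup (map (fun x => (f x, x)) lA)).
  { apply Injective_map_NoDup; [|exact HA]. intros x x' E. congruence. }
  apply Nat.le_antisymm; apply NoDup_incl_length; try assumption; intros yx; apply same.
Qed.

(** * Counting cusps *)

Definition isolated_cusp_eqs (p q : nat) (a b : C) : Prop :=
  forall z w, cusp_eqs p q a b z w -> exists d, 0 < d /\
    forall z' w', cusp_eqs p q a b z' w' -> Cmod (z' - z) < d -> Cmod (w' - w) < d ->
      z' = z /\ w' = w.

Lemma pow_deriv_mult (p : nat) (z t : C) : pow_deriv p (z * t) = (pow_deriv p z * t ^ (p - 1))%C.
Proof. unfold pow_deriv. rewrite Cpow_mult_l. ring. Qed.

Lemma neq0_of_pow_deriv_neq0 (p : nat) (z : C) : (2 <= p)%nat -> pow_deriv p z <> 0 -> z <> 0.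
Proof. intros hp h e. apply h. rewrite e. apply pow_deriv_0, hp. Qed.

Lemma pow_deriv_roots (p : nat) (c : C) : (2 <= p)%nat -> c <> 0 ->
  exists l, NoDup l /\ length l = (p - 1)%nat /\ forall y, In y l <-> pow_deriv p y = c.
Proof.
  intros hp hc. pose proof (INR_C_neq0 p ltac:(lia)) as hI.
  destruct (pow_roots (p - 1) (c / INR p)%C) as [l [Hl [Hn H]]]; [lia| |].
  - intros h. apply hc. replace c with (INR p * (c / INR p))%C by (field; exact hI).
    rewrite h. ring.
  - exists l. split; [exact Hl|]. split; [exact Hn|]. intros y. rewrite H. unfold pow_deriv. split.
    + intros ->. field. exact hI.
    + intros <-. field. exact hI.
Qed.

Lemma pow_deriv_onto (p : nat) (c : C) : (2 <= p)%nat -> exists z, pow_deriv p z = c.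
Proof.
  intros hp. destruct (Ceq_dec c 0) as [->|hc]; [exists 0; apply pow_deriv_0, hp|].
  destruct (pow_deriv_roots p c hp hc) as [[|z l] [_ [Hlen H]]]; [simpl in Hlen; lia|].
  exists z. apply H. left. reflexivity.
Qed.

Lemma Cmod_unit_pow (y : C) (n : nat) : Cmod y = 1 -> Cmod (y ^ n) = 1.
Proof. intros h. rewrite Cmod_pow, h. apply pow1. Qed.

Lemma unit_neq0 (y : C) : Cmod y = 1 -> y <> 0.
Proof. intros h. apply Cmod_gt_0. lra. Qed.

Lemma unit_of_pow (y c : C) (n : nat) : (0 < n)%nat -> (y ^ n)%C = c -> Cmod c = 1 -> Cmod y = 1.
Proof.
  intros hn E hc. apply (pow_inj_nonneg n); [exact hn|apply Cmod_ge_0|lra|].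
  rewrite <- Cmod_pow, E, hc, pow1. reflexivity.
Qed.

Lemma unit_pow_mult_conj (y : C) (m k : nat) : Cmod y = 1 ->
  (y ^ (m + k) * Cconj (y ^ m))%C = (y ^ k)%C.
Proof.
  intros h. transitivity (y ^ m * Cconj (y ^ m) * y ^ k)%C; [rewrite Cpow_add_r; ring|].
  rewrite Cmod1_conj by apply Cmod_unit_pow, h. ring.
Qed.

(* For [u = 1] the singular points are the [(zt, w0)] with [pow_deriv p zt = - conj a] and
   [pow_deriv q w0 = - conj b]. Fixing [w0], the circles [{zt} x {|y| = 1}] cover the singular
   set [(p - 1)]-to-one; if [b = 0], then [q = 2] and [w0 = 0]. *)
Section Covering.
Context (p q : nat) (a b w0 : C) (hq : (2 <= q)%nat) (hqp : (q <= p)%nat).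
Context (ha : a <> 0) (hb : b = 0 -> q = 2%nat) (Hw0 : pow_deriv q w0 = (- Cconj b)%C).

Definition cover (x : C * C) : C * C :=
  (fst x * snd x ^ (q - 1), w0 * snd x ^ (p - 1))%C.

Definition on_cover (zt y : C) : Prop :=
  Cmod y = 1 /\ cusp_eqs p q a b (zt * y ^ (q - 1)) (w0 * y ^ (p - 1)).

Lemma cover_singular (zt y : C) : pow_deriv p zt = (- Cconj a)%C -> Cmod y = 1 ->
  singular_at p q a b (zt * y ^ (q - 1)) (w0 * y ^ (p - 1)) (y ^ ((p - 1) * (q - 1))).
Proof.
  intros Hzt my. split; [apply Cmod_unit_pow, my|].
  rewrite !pow_deriv_mult, Hzt, Hw0, <- !Cpow_mult_r, (Nat.mul_comm (q - 1)). split; ring.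
Qed.

Lemma singular_at_unique (z w u u' : C) :
  singular_at p q a b z w u -> singular_at p q a b z w u' -> u = u'.
Proof.
  intros [_ [H _]] [_ [H' _]]. pose proof (Cconj_neq0 a ha) as hca.
  replace u with (- - (u * Cconj a) / Cconj a)%C by (field; exact hca).
  rewrite <- H, H'. field. exact hca.
Qed.

Lemma on_cover_iff (zt y : C) : pow_deriv p zt = (- Cconj a)%C -> Cmod y = 1 ->
  on_cover zt y <->
  (cusp_form p q (zt * y ^ (q - 1)) (w0 * y ^ (p - 1)) + y ^ ((p - 1) * (q - 1))
     * Cconj (cusp_form p q (zt * y ^ (q - 1)) (w0 * y ^ (p - 1))))%C = 0.
Proof.
  intros Hzt my. pose proof (cover_singular zt y Hzt my) as Hy. split.
  - intros [_ [u [Hu E]]]. rewrite <- (singular_at_unique _ _ _ _ Hu Hy). exact E.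
  - intros E. split; [exact my|]. eexists. split; [exact Hy|exact E].
Qed.

Lemma cover_root_neq0 (zt : C) : pow_deriv p zt = (- Cconj a)%C -> zt <> 0.
Proof.
  intros H. apply (neq0_of_pow_deriv_neq0 p zt ltac:(lia)). rewrite H.
  apply Copp_neq0, Cconj_neq0, ha.
Qed.

Let coeff_z (zt : C) : C := (INR p * INR (q - 1) * zt ^ p)%C.
Let coeff_w : C := (INR q * INR (p - 1) * w0 ^ q)%C.

Lemma cusp_form_cover (zt y : C) :
  cusp_form p q (zt * y ^ (q - 1)) (w0 * y ^ (p - 1))
  = (coeff_z zt * y ^ (p * (q - 1)) + coeff_w * y ^ (q * (p - 1)))%C.
Proof.
  unfold cusp_form, coeff_z, coeff_w. rewrite !Cpow_mult_l, <- !Cpow_mult_r.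
  rewrite (Nat.mul_comm (q - 1) p), (Nat.mul_comm (p - 1) q). ring.
Qed.

Definition cover_poly (zt y : C) : C :=
  (coeff_z zt * y ^ (p * (q - 1) + (p - 1)) + coeff_w * y ^ (q * (p - 1) + (p - 1))
   + (Cconj (coeff_z zt) * y ^ (p - q) + Cconj coeff_w * y ^ 0))%C.

Lemma cover_poly_deg_le (zt : C) : poly_deg_le ((p - 1) * (q + 1)) (cover_poly zt).
Proof. repeat apply poly_deg_le_plus; apply poly_deg_le_monomial; nia. Qed.

Lemma on_cover_iff_cover_poly (zt y : C) : pow_deriv p zt = (- Cconj a)%C -> Cmod y = 1 ->
  on_cover zt y <-> cover_poly zt y = 0.
Proof.
  intros Hzt my. rewrite on_cover_iff by assumption.
  assert (E : (y ^ (p - 1) * (cusp_form p q (zt * y ^ (q - 1)) (w0 * y ^ (p - 1))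
      + y ^ ((p - 1) * (q - 1)) * Cconj (cusp_form p q (zt * y ^ (q - 1)) (w0 * y ^ (p - 1)))))%C
    = cover_poly zt y).
  { rewrite cusp_form_cover, Cplus_conj, !Cmult_conj. unfold cover_poly.
    rewrite <- (unit_pow_mult_conj y (p * (q - 1)) (p - q) my).
    rewrite <- (unit_pow_mult_conj y (q * (p - 1)) 0 my).
    replace (p * (q - 1) + (p - q))%nat with ((p - 1) + (p - 1) * (q - 1))%nat by nia.
    replace (q * (p - 1) + 0)%nat with ((p - 1) + (p - 1) * (q - 1))%nat by nia.
    rewrite !Cpow_add_r. ring. }
  split.
  - intros H. rewrite <- E, H. ring.
  - intros H. rewrite H in E. apply Cmult_integral in E.
    destruct E as [E|E]; [exfalso|exact E]. exact (Cpow_nz y (p - 1) (unit_neq0 y my) E).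
Qed.

(* A circle of cusps through [(zt, w0)] would accumulate there. *)
Lemma on_cover_not_all (zt : C) :
  isolated_cusp_eqs p q a b -> pow_deriv p zt = (- Cconj a)%C ->
  exists y, Cmod y = 1 /\ ~ on_cover zt y.
Proof.
  intros Hiso Hzt. apply NNPP. intros Hn.
  assert (all : forall t, cusp_eqs p q a b
    (zt * cis (INR (q - 1) * t)) (w0 * cis (INR (p - 1) * t))).
  { intros t. rewrite <- !cis_pow. apply NNPP. intros h. apply Hn. exists (cis t).
    split; [apply Cmod_cis|]. intros [_ H]. exact (h H). }
  pose proof (all 0) as cusp_1. rewrite !Rmult_0_r, cis_0, !Cmult_1_r in cusp_1.
  destruct (Hiso _ _ cusp_1) as [d [hd Hd]].
  pose proof (Cmod_ge_0 zt). pose proof (Cmod_ge_0 w0).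
  assert (hp : 0 < INR (p - 1) <= INR p) by (split; [apply lt_0_INR|apply le_INR]; lia).
  assert (hq' : 0 < INR (q - 1) <= INR p) by (split; [apply lt_0_INR|apply le_INR]; lia).
  destruct (small_rotation (Cmod zt + Cmod w0) (INR p) d) as [t [ht small]]; [lra|lra|exact hd|].
  destruct (small zt (INR (q - 1)) ltac:(lra) hq') as [hrange Hz].
  destruct (small w0 (INR (p - 1)) ltac:(lra) hp) as [_ Hw].
  destruct (Hd _ _ (all t) Hz Hw) as [E _].
  pose proof PI2_1 as hpi.
  apply (cis_neq_1 (INR (q - 1) * t)); [split; [apply Rmult_lt_0_compat|]; lra|].
  pose proof (cover_root_neq0 zt Hzt) as hzt.
  replace (cis (INR (q - 1) * t)) with (zt * cis (INR (q - 1) * t) / zt)%C by (field; exact hzt).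
  rewrite E. field. exact hzt.
Qed.

Lemma on_cover_upper (zt : C) (l : list C) :
  isolated_cusp_eqs p q a b -> pow_deriv p zt = (- Cconj a)%C ->
  NoDup l -> (forall y, In y l -> on_cover zt y) -> (length l <= (p - 1) * (q + 1))%nat.
Proof.
  intros Hiso Hzt Hl H. destruct (on_cover_not_all zt Hiso Hzt) as [y0 [my0 Hy0]].
  apply (poly_deg_le_roots _ (cover_poly zt) l y0); [apply cover_poly_deg_le| |exact Hl|].
  - intros h. apply Hy0, on_cover_iff_cover_poly; assumption.
  - intros y hy. apply H in hy. apply on_cover_iff_cover_poly; [exact Hzt|apply hy|exact hy].
Qed.

(* Multiplying the equation at [y = e^(ix)] by the conormal [e^(-iNx/2)], [N = (p - 1)(q - 1)],
   turns its left-hand side into twice a real part. *)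
Lemma on_cover_cis (zt : C) (th om x : R) : pow_deriv p zt = (- Cconj a)%C ->
  zt = (Cmod zt * cis th)%C -> w0 = (Cmod w0 * cis om)%C ->
  on_cover zt (cis x) <->
  INR p * INR (q - 1) * Cmod zt ^ p * cos (INR p * th + INR ((p + 1) * (q - 1)) / 2 * x)
  + INR q * INR (p - 1) * Cmod w0 ^ q
    * cos (INR q * om + INR ((p + 1) * (q - 1) + 2 * (p - q)) / 2 * x) = 0.
Proof.
  intros Hzt Eth Eom. rewrite on_cover_iff by (exact Hzt || apply Cmod_cis).
  rewrite cusp_form_cover, !cis_pow. set (N := INR ((p - 1) * (q - 1))).
  rewrite <- (Re_mult_eq0_iff (cis (- (N / 2 * x))));
    [|apply unit_neq0, Cmod_cis|rewrite Cconj_cis, <- cis_plus; f_equal; field].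
  assert (half : forall m n k : nat, (m + k = 2 * n)%nat -> INR m = 2 * INR n - INR k).
  { intros m n k E. rewrite <- (mult_INR 2), <- E, plus_INR. ring. }
  rewrite (half ((p + 1) * (q - 1))%nat (p * (q - 1))%nat ((p - 1) * (q - 1))%nat) by nia.
  rewrite (half ((p + 1) * (q - 1) + 2 * (p - q))%nat (q * (p - 1))%nat
    ((p - 1) * (q - 1))%nat) by nia.
  fold N. unfold coeff_z, coeff_w. rewrite Eth, Eom at 1.
  rewrite !Cpow_mult_l, !cis_pow, <- !RtoC_pow.
  replace (INR p * th + (2 * INR (p * (q - 1)) - N) / 2 * x)
    with (- (N / 2 * x) + (INR p * th + INR (p * (q - 1)) * x)) by field.
  replace (INR q * om + (2 * INR (q * (p - 1)) - N) / 2 * x)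
    with (- (N / 2 * x) + (INR q * om + INR (q * (p - 1)) * x)) by field.
  match goal with |- Re ?c = 0 <-> ?r = 0 => replace (Re c) with r; [tauto|] end.
  change (cos ?t) with (Re (cis t)). rewrite <- !re_scal_l, <- re_plus. f_equal.
  rewrite !cis_plus, !RtoC_mult. ring.
Qed.

Lemma on_cover_lower (zt : C) : pow_deriv p zt = (- Cconj a)%C ->
  exists l, NoDup l /\ ((p + 1) * (q - 1) <= length l)%nat /\ forall y, In y l -> on_cover zt y.
Proof.
  intros Hzt.
  destruct (polar zt) as [th Eth]. destruct (polar w0) as [om Eom].
  pose proof (proj1 (Cmod_gt_0 zt) (cover_root_neq0 zt Hzt)) as mz.
  pose proof (Cmod_ge_0 w0) as mw.
  destruct (two_cos_zeros (INR p * INR (q - 1) * Cmod zt ^ p) (INR q * INR (p - 1) * Cmod w0 ^ q)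
    (INR p * th) (INR q * om) ((p + 1) * (q - 1)) (p - q)) as [x0 [l [Hl [Hn Hz]]]].
  - repeat apply Rmult_lt_0_compat; try (apply lt_0_INR; lia). apply pow_lt, mz.
  - repeat apply Rmult_le_pos; try apply pos_INR. apply pow_le, mw.
  - nia.
  - exists (map cis l). split; [|split].
    + apply Injective_map_NoDup_in; [|exact Hl].
      intros x y hx hy. apply (cis_inj x0); apply Hz; assumption.
    + rewrite length_map. exact Hn.
    + intros y hy. apply in_map_iff in hy. destruct hy as [x [<- hx]].
      apply (on_cover_cis zt th om x Hzt Eth Eom), Hz, hx.
Qed.

Lemma on_cover_count (zt : C) :
  isolated_cusp_eqs p q a b -> pow_deriv p zt = (- Cconj a)%C ->
  exists l, NoDup l /\ ((p + 1) * (q - 1) <= length l <= (p - 1) * (q + 1))%nat /\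
    forall y, In y l <-> on_cover zt y.
Proof.
  intros Hiso Hzt.
  destruct (list_of_bounded_set (on_cover zt) ((p - 1) * (q + 1))) as [l [Hl H]].
  { intros l Hl H. apply (on_cover_upper zt l); assumption. }
  exists l. split; [exact Hl|]. split; [|exact H]. split.
  - destruct (on_cover_lower zt Hzt) as [l' [Hl' [Hn H']]].
    eapply Nat.le_trans; [exact Hn|]. apply NoDup_incl_length; [exact Hl'|].
    intros y hy. apply H, H', hy.
  - apply (on_cover_upper zt l); auto. intros y hy. apply H, hy.
Qed.

Lemma singular_at_phase (z w u : C) : singular_at p q a b z w u ->
  exists c, Cmod c = 1 /\ w = (w0 * c)%C /\ u = (c ^ (q - 1))%C.
Proof.
  intros [hu [_ Hw]]. destruct (Ceq_dec b 0) as [e|e].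
  - assert (pow_deriv_2 : forall v, pow_deriv 2 v = 0 -> v = 0).
    { intros v H. unfold pow_deriv in H. simpl Nat.sub in H. rewrite Cpow_1_r in H.
      apply Cmult_integral in H. destruct H as [H|H]; [|exact H].
      exfalso. revert H. apply INR_C_neq0. lia. }
    pose proof (hb e) as q2. rewrite q2, e, Cconj_0 in *.
    exists u. split; [exact hu|]. split; [|rewrite Cpow_1_r; reflexivity].
    rewrite (pow_deriv_2 w), (pow_deriv_2 w0).
    + ring.
    + rewrite Hw0. ring.
    + rewrite Hw. ring.
  - pose proof (Cconj_neq0 b e) as hcb.
    assert (hw0 : w0 <> 0)
      by (apply (neq0_of_pow_deriv_neq0 q w0 hq); rewrite Hw0; apply Copp_neq0, hcb).
    assert (Ew : w = (w0 * (w / w0))%C) by (field; exact hw0).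
    assert (Eu : u = ((w / w0) ^ (q - 1))%C).
    { rewrite Ew, pow_deriv_mult, Hw0 in Hw.
      replace u with (- - (u * Cconj b) / Cconj b)%C by (field; exact hcb).
      rewrite <- Hw. field. exact hcb. }
    exists (w / w0)%C. split; [|split; assumption].
    apply (unit_of_pow _ u (q - 1)); [lia|symmetry; exact Eu|exact hu].
Qed.

Lemma cover_fibre_iff (z w u c zt y : C) :
  singular_at p q a b z w u -> Cmod c = 1 -> w = (w0 * c)%C -> u = (c ^ (q - 1))%C ->
  (pow_deriv p zt = (- Cconj a)%C /\ Cmod y = 1 /\ cover (zt, y) = (z, w)) <->
  ((y ^ (p - 1))%C = c /\ zt = (z / y ^ (q - 1))%C).
Proof.
  intros [_ [Hz _]] mc -> ->. unfold cover. cbn [fst snd].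
  pose proof (Cconj_neq0 a ha) as hca. split.
  - intros [Hzt [my E]]. apply pair_equal_spec in E. destruct E as [Ez Ew].
    assert (hyq : (y ^ (q - 1))%C <> 0) by apply Cpow_nz, unit_neq0, my.
    split; [|rewrite <- Ez; field; exact hyq].
    destruct (Ceq_dec b 0) as [e|e].
    + rewrite <- Ez, pow_deriv_mult, Hzt, (hb e), !Cpow_1_r in Hz.
      replace (y ^ (p - 1))%C with (- (- Cconj a * y ^ (p - 1)) / Cconj a)%C
        by (field; exact hca).
      rewrite Hz. field. exact hca.
    + assert (hw0 : w0 <> 0).
      { apply (neq0_of_pow_deriv_neq0 q w0 hq). rewrite Hw0. apply Copp_neq0, Cconj_neq0, e. }
      replace (y ^ (p - 1))%C with (w0 * y ^ (p - 1) / w0)%C by (field; exact hw0).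
      rewrite Ew. field. exact hw0.
  - intros [<- ->]. pose proof (unit_of_pow y _ (p - 1) ltac:(lia) eq_refl mc) as my.
    assert (hyq : (y ^ (q - 1))%C <> 0) by apply Cpow_nz, unit_neq0, my.
    assert (Ez : (z / y ^ (q - 1) * y ^ (q - 1))%C = z) by (field; exact hyq).
    split; [|split; [exact my|f_equal; exact Ez]].
    rewrite <- Ez, pow_deriv_mult, <- !Cpow_mult_r, (Nat.mul_comm (q - 1)) in Hz.
    assert (hN : (y ^ ((p - 1) * (q - 1)))%C <> 0) by apply Cpow_nz, unit_neq0, my.
    replace (pow_deriv p (z / y ^ (q - 1))) with
      (pow_deriv p (z / y ^ (q - 1)) * y ^ ((p - 1) * (q - 1)) / y ^ ((p - 1) * (q - 1)))%C
      by (field; auto).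
    rewrite Hz. field. exact hN.
Qed.

Lemma cover_fibre_list (z w u : C) : singular_at p q a b z w u ->
  exists l, NoDup l /\ length l = (p - 1)%nat /\ forall zt y, In (zt, y) l <->
    pow_deriv p zt = (- Cconj a)%C /\ Cmod y = 1 /\ cover (zt, y) = (z, w).
Proof.
  intros Hu. destruct (singular_at_phase z w u Hu) as [c [mc [Ew Eu]]].
  destruct (pow_roots (p - 1) c) as [l [Hl [Hlen Hy]]]; [lia|apply unit_neq0, mc|].
  exists (map (fun y => (z / y ^ (q - 1), y)%C) l). split; [|split].
  - apply Injective_map_NoDup; [|exact Hl]. intros y y' E. congruence.
  - rewrite length_map. exact Hlen.
  - intros zt y. rewrite (cover_fibre_iff z w u c zt y Hu mc Ew Eu), in_map_iff, <- Hy. split.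
    + intros [y' [E hy']]. injection E as <- <-. auto.
    + intros [hy ->]. exists y. auto.
Qed.

Lemma cusp_eqs_count_of_cover : isolated_cusp_eqs p q a b ->
  exists l, NoDup l /\ ((p + 1) * (q - 1) <= length l <= (p - 1) * (q + 1))%nat /\
    forall x, In x l <-> cusp_eqs p q a b (fst x) (snd x).
Proof.
  intros Hiso.
  destruct (pow_deriv_roots p (- Cconj a)%C) as [roots [Hroots [Hlen Hroot]]];
    [lia|apply Copp_neq0, Cconj_neq0, ha|].
  destruct (list_of_relation on_cover ((p + 1) * (q - 1)) ((p - 1) * (q + 1)) roots Hroots)
    as [covering [Hcovering [Hcount Hin_covering]]].
  { intros zt hzt. apply on_cover_count; [exact Hiso|apply Hroot, hzt]. }
  destruct (count_of_constant_fibres (fun x y : C * C => ltac:(decide equality; apply Ceq_dec))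
    cover covering (fun x => cusp_eqs p q a b (fst x) (snd x)) (p - 1))
    as [cusps [Hcusps [Hin_cusps Hfibres]]].
  - lia.
  - exact Hcovering.
  - intros [zt y] h. apply Hin_covering in h. apply h.
  - intros [z w] [u [Hu HG]]. destruct (cover_fibre_list z w u Hu) as [l [Hl [Hn H]]].
    exists l. split; [exact Hl|]. split; [exact Hn|]. intros [zt y].
    rewrite H, Hin_covering, Hroot. split.
    + intros [hzt [my E]]. split; [|exact E]. split; [exact hzt|]. split; [exact my|].
      apply pair_equal_spec in E. cbn [fst snd] in E. destruct E as [-> ->].
      exists u. split; assumption.
    + intros [[hzt [my _]] E]. auto.
  - exists cusps. split; [exact Hcusps|]. split; [|exact Hin_cusps].
    rewrite <- Hfibres, Hlen in Hcount. nia.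
Qed.

End Covering.

Lemma cusp_eqs_swap (p q : nat) (a b z w : C) :
  cusp_eqs p q a b z w -> cusp_eqs q p b a w z.
Proof.
  assert (E : cusp_form p q z w = cusp_form q p w z) by (unfold cusp_form; ring).
  intros [u [[hu [Hz Hw]] HG]]. exists u. split; [repeat split; assumption|].
  rewrite <- E. exact HG.
Qed.

Lemma isolated_cusp_eqs_swap (p q : nat) (a b : C) :
  isolated_cusp_eqs p q a b -> isolated_cusp_eqs q p b a.
Proof.
  intros H w z Hwz. destruct (H z w (cusp_eqs_swap _ _ _ _ _ _ Hwz)) as [d [hd Hd]].
  exists d. split; [exact hd|]. intros w' z' Hwz' hw hz.
  destruct (Hd z' w' (cusp_eqs_swap _ _ _ _ _ _ Hwz') hz hw). split; assumption.
Qed.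

Section CountingCusps.
Context (p q : nat) (a b : C) (hq : (2 <= q)%nat) (hqp : (q <= p)%nat).
Context (exc : excellent (Fmap p q a b)).

Let hp : (2 <= p)%nat := Nat.le_trans _ _ _ hq hqp.

Lemma excellent_isolated_cusp_eqs : isolated_cusp_eqs p q a b.
Proof.
  assert (cusp_zw_point : forall z w,
    cusp_eqs p q a b z w -> is_cusp (Fmap p q a b) (zw_point z w)).
  { intros z w H. apply (is_cusp_iff p q a b hp hq exc).
    rewrite z_coord_point, w_coord_point. exact H. }
  intros z w H.
  destruct (cusp_isolated _ _ _ (Fmap_jet2 p q a b) _ (cusp_zw_point z w H)) as [d Hd].
  exists d. split; [apply cond_pos|]. intros z' w' H' hz hw.
  assert (bound : forall c c' : C, Cmod (c' - c) < d ->
    Rabs (fst c' - fst c) < d /\ Rabs (snd c' - snd c) < d).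
  { intros c c' h. pose proof (Rmax_Cmod (c' - c)%C) as max_le.
    pose proof (Rmax_l (Rabs (fst (c' - c)%C)) (Rabs (snd (c' - c)%C))).
    pose proof (Rmax_r (Rabs (fst (c' - c)%C)) (Rabs (snd (c' - c)%C))).
    split; eapply Rle_lt_trans; try exact h;
      eapply Rle_trans; try exact max_le; assumption. }
  destruct (bound z z' hz) as [n0 n1]. destruct (bound w w' hw) as [n2 n3].
  apply zw_point_inj, Hd; [|apply cusp_zw_point, H'].
  intros [|[|[|[|i]]]] hi; try assumption. lia.
Qed.

Lemma pow_deriv2_0 (n : nat) : n <> 2%nat -> (2 <= n)%nat -> pow_deriv2 n 0 = 0.
Proof.
  intros h hn. unfold pow_deriv2. replace (n - 2)%nat with (S (n - 3)) by lia. rewrite Cpow_S. ring.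
Qed.

Lemma excellent_pow_deriv2_neq0 (z w : C) :
  pow_deriv p z = (- Cconj a)%C -> pow_deriv q w = (- Cconj b)%C ->
  pow_deriv2 p z <> 0 /\ pow_deriv2 q w <> 0.
Proof.
  intros Hz Hw.
  pose proof (singular_at_pow_deriv2_neq0 p q a b hp hq exc (zw_point z w) 1) as H.
  rewrite z_coord_point, w_coord_point in H. apply H.
  split; [apply Cmod_1|]. rewrite !Cmult_1_l. split; assumption.
Qed.

Lemma excellent_b_eq0 : b = 0 -> q = 2%nat.
Proof.
  intros hb. apply NNPP. intros h. destruct (pow_deriv_onto p (- Cconj a)%C hp) as [z Hz].
  apply (excellent_pow_deriv2_neq0 z 0 Hz); [|exact (pow_deriv2_0 q h hq)].
  rewrite hb, Cconj_0, pow_deriv_0 by exact hq. ring.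
Qed.

Lemma excellent_a_eq0 : a = 0 -> p = 2%nat.
Proof.
  intros ha. apply NNPP. intros h. destruct (pow_deriv_onto q (- Cconj b)%C hq) as [w Hw].
  destruct (excellent_pow_deriv2_neq0 0 w) as [Hp _]; [|exact Hw|exact (Hp (pow_deriv2_0 p h hp))].
  rewrite ha, Cconj_0, pow_deriv_0 by exact hp. ring.
Qed.

Lemma cusp_eqs_count :
  exists l, NoDup l /\ ((p + 1) * (q - 1) <= length l <= (p - 1) * (q + 1))%nat /\
    forall x, In x l <-> cusp_eqs p q a b (fst x) (snd x).
Proof.
  destruct (Ceq_dec a 0) as [ha|ha].
  - pose proof (excellent_a_eq0 ha) as p2. assert (q2 : q = 2%nat) by lia.
    assert (hb : b <> 0)
      by (destruct (excellent_coeffs p q a b hp hq exc); [contradiction|assumption]).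
    destruct (pow_deriv_onto p (- Cconj a)%C hp) as [z0 Hz0].
    destruct (cusp_eqs_count_of_cover q p b a z0 hp ltac:(lia) hb (fun _ => p2) Hz0
      (isolated_cusp_eqs_swap _ _ _ _ excellent_isolated_cusp_eqs)) as [l [Hl [Hn H]]].
    exists (map (fun x => (snd x, fst x)) l). split; [|split].
    + apply Injective_map_NoDup; [|exact Hl]. intros [z w] [z' w'] E.
      apply pair_equal_spec in E. cbn [fst snd] in E. destruct E as [-> ->]. reflexivity.
    + rewrite length_map. rewrite p2, q2 in *. exact Hn.
    + intros [z w]. rewrite in_map_iff. cbn [fst snd]. split.
      * intros [[w' z'] [E h]]. apply pair_equal_spec in E. cbn [fst snd] in E.
        destruct E as [<- <-]. apply cusp_eqs_swap, (H (w', z')), h.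
      * intros h. exists (w, z). split; [reflexivity|]. apply H, cusp_eqs_swap, h.
  - destruct (pow_deriv_onto q (- Cconj b)%C hq) as [w0 Hw0].
    exact (cusp_eqs_count_of_cover p q a b w0 hq hqp ha excellent_b_eq0 Hw0
      excellent_isolated_cusp_eqs).
Qed.

End CountingCusps.

Theorem theorem1p2 (p q : nat) (a b : Cx) :
  (2 <= q)%nat -> (q <= p)%nat -> excellent (Fmap p q a b) ->
  exists l : list (Rn 4),
    NoDup l /\
    (forall x, is_cusp (Fmap p q a b) x <-> In x l) /\
    ((p + 1) * (q - 1) <= length l <= (p - 1) * (q + 1))%nat /\
    (p = q -> length l = (p * p - 1)%nat).
Proof.
  intros hq hqp exc. assert (hp : (2 <= p)%nat) by lia.
  destruct (cusp_eqs_count p q a b hq hqp exc) as [l [Hl [Hn H]]].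
  exists (map (fun x => zw_point (fst x) (snd x)) l). rewrite length_map.
  split; [|split; [|split; [exact Hn|]]].
  - apply Injective_map_NoDup; [|exact Hl]. intros [z w] [z' w'] E.
    apply zw_point_inj in E. f_equal; apply E.
  - intros x. rewrite (is_cusp_iff p q a b hp hq exc), in_map_iff. split.
    + intros h. exists (z_coord x, w_coord x). split; [apply zw_point_coords|]. apply H, h.
    + intros [y [<- h]]. rewrite z_coord_point, w_coord_point. apply H, h.
  - intros <-. nia.
Qed.
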